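(* Fix $\theta>0$. For $\alpha>0$ let $q^{(\alpha,\theta)}$ denote the composition structure derived from the stick-breaking paintbox $U_{\alpha,\theta}$ directed by the beta density $$\mathrm{d}\omega_{\alpha,\theta}(z)=\mathrm{const}\cdot z^{\alpha-1}(1-z)^{\theta-1}\,\mathrm{d}z,\qquad z\in[0,1].$$ Then, as $\alpha\downarrow 0$, $q^{(\alpha,\theta)}$ converges to $g$; that is, for every $n\ge 1$ and every composition $\lambda=(\lambda_1,\ldots,\lambda_\ell)$ of $n$, $$\lim_{\alpha\downarrow 0} q^{(\alpha,\theta)}(\lambda)=g(\lambda):=\frac{n!}{[\theta]_n}\prod_{j=1}^{\ell}\frac{1}{\lambda_j\,h_\theta(\Lambda_j)},$$ where $\Lambda_j=\lambda_j+\cdots+\lambda_\ell$ and $h_\theta(m)=\sum_{k=1}^{m}\frac{1}{\theta+k-1}$.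
   Context: A composition of weight $n$ and length $\ell$ is an ordered sequence $\lambda=(\lambda_1,\ldots,\lambda_\ell)$ of positive integers with $\sum_j\lambda_j=n$ (written $\lambda\vdash n$). The Pochhammer factorial is $[x]_n=x(x+1)\cdots(x+n-1)$, $[x]_0=1$. A composition structure is a nonnegative function $q$ on compositions such that for each $n$ the values $\{q(\lambda):\lambda\vdash n\}$ form a probability distribution $q_n$, and the $q_n$'s are sampling consistent: if balls are placed in an ordered series of nonempty boxes with occupancy numbers, from left to right, distributed according to $q_n$, and $k<n$ balls are removed uniformly at random, then the reduced occupancy numbers of the nonempty boxes (in the same order) have distribution $q_{n-k}$. Paintbox construction: a paintbox is a random open subset $U$ of $[0,1]$. It induces an ordered partition of $[0,1]$ whose blocks are the component intervals of $U$ and the individual points of the complement $U^c=[0,1]\setminus U$, ordered by the order on the reals. Sample $n$ independent uniform points from $[0,1]$, independently of $U$; recording the nonzero numbers of sample points in the blocks, from left to right, gives a random composition of $n$. The composition structure derived from $U$ assigns to each $\lambda\vdash n$ the probability that this random composition equals $\lambda$. Stick-breaking paintbox directed by a probability distribution $\omega$ on $[0,1]$: let $Z_1,Z_2,\ldots$ be independent random variables with distribution $\omega$; the paintbox is the open set complementary in $[0,1]$ to the set consisting of the points $1-\prod_{j=1}^{k}(1-Z_j)$, $k=1,2,\ldots$, together with the endpoints $0$ and $1$. The paintbox $U_{\alpha,\theta}$ is the one obtained with $\omega=\omega_{\alpha,\theta}$, where ''const'' is the normalizing constant making $\omega_{\alpha,\theta}$ a probability distribution. *)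

(* Defs.v *)
(* MathComp / MathComp-Analysis. *)
From HB Require Import structures.
From mathcomp Require Import all_boot all_order all_algebra.
From mathcomp Require Import all_classical all_reals all_analysis.

Set Implicit Arguments.
Unset Strict Implicit.
Unset Printing Implicit Defensive.

Import Order.TTheory GRing.Theory Num.Theory.
Import numFieldNormedType.Exports.

Local Open Scope classical_set_scope.
Local Open Scope ring_scope.

Definition is_composition (n : nat) (la : seq nat) : bool :=
  all (leq 1) la && (sumn la == n).

Section Composition.
Context {R : realType}.
Implicit Types (U : set R) (x : R).

(* The block containing [x] of the ordered partition induced by [U]. *)
Definition block U x : set R :=
  if x \in U then connected_component U x else [set x].

(* The order on blocks induced by the order of [R]; it is total on the blocks
   of a given [U], since distinct blocks are disjoint intervals. *)
Definition block_le (A B : set R) : bool :=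
  `[< A = B \/ forall a b, A a -> B b -> a < b >].

(* The blocks that are hit by the sample, from left to right, are replaced
   by the numbers of sample points they contain. *)
Definition sample_composition U (xs : seq R) : seq nat :=
  [seq count (fun x => block U x == B) xs
     | B <- sort block_le (undup [seq block U x | x <- xs])].

(* [Z j] stands for the (j+1)-st stick-breaking factor. The set is open when
   the products tend to 0, hence almost surely for the laws considered here. *)
Definition stick_breaking_paintbox (Z : nat -> R) : set R :=
  `[0, 1] `\` ([set 0; 1] `|`
               [set 1 - \prod_(j < k.+1) (1 - Z j) | k in [set: nat]]).

End Composition.

Section Probability.
Context {R : realType} {d : measure_display} {T : measurableType d}.
Variable P : probability T R.

Definition mutually_independent (I : eqType) (X : I -> {RV P >-> R}) : Prop :=
  forall (s : seq I) (A : I -> set R),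
    uniq s -> (forall i, measurable (A i)) ->
    P (\big[setI/setT]_(i <- s) (X i @^-1` A i))
    = (\prod_(i <- s) P (X i @^-1` A i))%E.

Definition has_law (X : {RV P >-> R}) (mu : set R -> \bar R) : Prop :=
  forall A, measurable A -> distribution P X A = mu A.

(* The value at [la] of the composition structure derived from the random
   set [U], the sample of size [n] being [V 0, ..., V n.-1]. *)
Definition paintbox_prob (U : T -> set R) (V : nat -> {RV P >-> R})
    (la : seq nat) : \bar R :=
  P [set w | sample_composition (U w)
               [seq V i w | i <- iota 0 (sumn la)] = la].

End Probability.

(* [q] is the composition structure derived from the stick-breaking paintbox
   directed by [omega]. The joint independence of the factors and the sample
   points makes the sample independent of the paintbox. The law of the random
   composition does not depend on the choice of the probability space. *)
Definition stick_breaking_structure (R : realType) (omega : set R -> \bar R)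
    (q : seq nat -> R) : Prop :=
  exists (d : measure_display) (T : measurableType d) (P : probability T R)
         (Z V : nat -> {RV P >-> R}),
    [/\ forall k, has_law (Z k) omega,
        forall i, has_law (V i) (uniform_prob (@ltr01 R)),
        mutually_independent
          (fun s : nat + nat => match s with inl k => Z k | inr i => V i end)
      & forall n la, is_composition n la ->
          paintbox_prob (fun w => stick_breaking_paintbox (fun k => Z k w)) V la
          = (q la)%:E].

Section Beta.
Context {R : realType}.
Implicit Types a theta : R.

(* MathComp-Analysis' [beta_prob] only has integer parameters. *)
Definition beta_weight a theta (z : R) : R :=
  z `^ (a - 1) * (1 - z) `^ (theta - 1).

Definition beta_norm a theta : R :=
  \int[lebesgue_measure]_(z in `[0, 1]) beta_weight a theta z.

Definition beta_law a theta (A : set R) : \bar R :=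
  (\int[lebesgue_measure]_(z in A `&` `[0%R, 1%R])
     ((beta_norm a theta)^-1 * beta_weight a theta z)%:E)%E.

End Beta.

Section Limit.
Context {R : realType}.
Variable theta : R.

Definition pochhammer (x : R) (n : nat) : R := \prod_(i < n) (x + i%:R).

Definition h_theta (m : nat) : R := \sum_(1 <= k < m.+1) (theta + k%:R - 1)^-1.

(* With 0-based [j], [sumn (drop j la)] is the tail sum
   la_j + la_(j+1) + ... of [la]. *)
Definition g_limit (la : seq nat) : R :=
  (sumn la)`!%:R / pochhammer theta (sumn la) *
  \prod_(j < size la) ((nth 0%N la j)%:R * h_theta (sumn (drop j la)))^-1.

End Limit.

(* Main.v *)
Require Import Defs.
From HB Require Import structures.
From mathcomp Require Import all_boot all_order all_algebra.
From mathcomp Require Import all_classical all_reals all_analysis.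
From mathcomp Require Import measurable_realfun.
From mathcomp Require Import ring lra zify.
Import Order.TTheory GRing.Theory Num.Theory.
Import numFieldNormedType.Exports.
Local Open Scope classical_set_scope.
Local Open Scope ring_scope.

(** Let [n] points be sampled, and let [Z] be the first stick-breaking factor.
    With probability ['C(n, m) * E(Z^m (1 - Z)^(n - m))], exactly [m] points lie
    left of the first break point, and the others see a rescaled copy of the
    same paintbox. Writing [mu m r] for [E(Z^m (1 - Z)^r)], this regeneration
    property reads
      [q (l :: la) = mu 0 n * q (l :: la) + 'C(n, l) * mu l (n - l) * q la].
    For the beta law, [mu m r] is [[a]_m [theta]_r / [a + theta]_(m + r)], by
    the functional equation of the beta integral. So [q] is a product of the
    decrement probabilities
      ['C(n, l) [a]_l [theta]_(n - l) / ([a + theta]_n - [theta]_n)].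
    Numerator and denominator both vanish to first order in [a]: the former is
    equivalent to [a 'C(n, l) (l - 1)! [theta]_(n - l)], the latter to [a] times
    the derivative of [x |-> [x]_n] at [theta], which is [[theta]_n h_theta(n)].
    The product of the limits telescopes to [g_limit].

    The regeneration property is derived without rescaling any point. Call stick
    [k] the interval between the break points [k] and [k + 1]. A word [f] of
    length [n] places point [i] in stick [f i]. Given the factors, this has
    probability the product of the lengths of these sticks, a monomial in the
    factors and their complements; hence its probability is a product of moments
    that depends only on the occupancy numbers of the word ([prob_in_sticks]).
    Summing over the words with letters below [M] whose nonzero occupancy
    numbers are [la] gives [truncated_prob M la]; separating the letter 0 turns
    this sum into a recursion on [M] ([truncated_probS]). Some point misses the
    first [M] sticks with probability at most [n * mu 0 1 ^ M]
    ([prob_sticks_ge]), so [truncated_prob M la] tends to [q la] and the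
    recursion passes to the limit.

    Two measure-theoretic facts support this. The value of a probability on a
    nonmeasurable set carries no information, so the event that the sampled
    composition is [la] must be measurable as it stands, and not only up to a
    null set; it is, because the composition depends only on which points share
    a block and on the order of the points, and two distinct points share a
    block when the segment between them lies inside the unit interval and
    contains no break point ([measurable_sample_composition]). And independence,
    a product rule for finitely many variables, is extended to generated
    sigma-algebras, so that one variable can be integrated out with the others
    fixed ([integral_history]). *)

Set Implicit Arguments.
Unset Strict Implicit.
Unset Printing Implicit Defensive.

(** * Words, occupancy numbers and the composition read from them *)

(** [sample_composition U xs] is [runs] of the list of blocks of the points.
    The general form lets blocks be replaced by the numbers of the sticks that
    contain the points. *)
Definition runs (T : eqType) (le : rel T) (s : seq T) : seq nat :=
  [seq count_mem b s | b <- sort le (undup s)].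

Lemma undup_map_eq (I T1 T2 : eqType) (h1 : I -> T1) (h2 : I -> T2) (s : seq I) :
  (forall i j, (h1 i == h1 j) = (h2 i == h2 j)) ->
  exists t, undup (map h1 s) = map h1 t /\ undup (map h2 s) = map h2 t.
Proof.
move=> h12; elim: s => [|i s [t [t1 t2]]]; first by exists [::].
have e : (h1 i \in map h1 s) = (h2 i \in map h2 s).
  by apply/mapP/mapP => -[j js /eqP ij]; exists j => //; apply/eqP; rewrite ?h12 // -h12.
rewrite /= e; case: ifP => _; first by exists t.
by exists (i :: t); rewrite t1 t2.
Qed.

(** The composition depends on the labels only through their equality pattern
    and their order. It serves twice: to replace blocks by stick numbers, and to
    show that the composition is a function of finitely many measurable tests. *)
Lemma runs_map_eq (I T1 T2 : eqType) (le1 : rel T1) (le2 : rel T2)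
    (h1 : I -> T1) (h2 : I -> T2) (s : seq I) :
  (forall i j, (h1 i == h1 j) = (h2 i == h2 j)) ->
  (forall i j, le1 (h1 i) (h1 j) = le2 (h2 i) (h2 j)) ->
  runs le1 (map h1 s) = runs le2 (map h2 s).
Proof.
move=> heq hle; rewrite /runs.
have [t [-> ->]] := undup_map_eq s heq.
rewrite !sort_map -!map_comp.
have -> : (relpre h1 le1 : rel I) = relpre h2 le2.
  by apply/funext => i; apply/funext => j; exact: hle.
apply: eq_map => i /=; rewrite !count_map.
by apply: eq_count => j /=; rewrite heq.
Qed.

Lemma sample_compositionE (R : realType) (U : set R) (xs : seq R) :
  sample_composition U xs = runs (@block_le R) (map (block U) xs).
Proof. by apply: eq_map => B; rewrite count_map. Qed.

Definition occupancy (M : nat) (f : seq nat) : seq nat :=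
  [seq count_mem k f | k <- iota 0 M].

(** Sorting the distinct letters of a word lists its alphabet in order, without
    the letters that do not occur. *)
Lemma runs_nat (M : nat) (f : seq nat) : all (fun k => k < M)%N f ->
  runs leq f = [seq c <- occupancy M f | c != 0%N].
Proof.
move=> /allP fM; rewrite /runs filter_map.
congr map; apply: (sorted_eq leq_trans anti_leq).
- exact/sort_sorted/leq_total.
- exact/(sorted_filter leq_trans)/iota_sorted.
apply: (perm_trans (permEl (perm_sort _ _))); apply: uniq_perm.
- exact: undup_uniq.
- exact/filter_uniq/iota_uniq.
move=> k; rewrite mem_undup mem_filter mem_iota /= -lt0n -has_count has_pred1 add0n.
by case: (boolP (k \in f)) => // /fM ->.
Qed.

Fixpoint words (M n : nat) : seq (seq nat) :=
  if n is n'.+1 then [seq k :: f | k <- iota 0 M, f <- words M n'] else [:: [::]].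

Lemma mem_words M n f :
  (f \in words M n) = (size f == n) && all (fun k => k < M)%N f.
Proof.
elim: n f => [|n IH] [|k f] //=.
- by apply/allpairsP => -[[k g] []].
- rewrite eqSS andbCA -IH; apply/allpairsP/andP => [[[k' g] [/= kM gw [-> ->]]]|[kM fw]].
    by split => //; move: kM; rewrite mem_iota add0n.
  by exists (k, f); split => //=; rewrite mem_iota add0n.
Qed.

Lemma uniq_words M n : uniq (words M n).
Proof.
elim: n => //= n IH; apply: allpairs_uniq => //; first exact: iota_uniq.
by move=> [k f] [k' f'] _ _ /= [-> ->].
Qed.

Lemma occupancy_nil M : occupancy M [::] = nseq M 0%N.
Proof. by rewrite /occupancy -[in RHS](size_iota 0 M); elim: iota => //= _ s ->. Qed.

Lemma occupancy_cons M k f : (k < M)%N ->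
  occupancy M (k :: f) = incr_nth (occupancy M f) k.
Proof.
move=> kM; apply: (@eq_from_nth _ 0%N).
  by rewrite size_incr_nth !size_map !size_iota kM.
move=> i; rewrite size_map size_iota => iM.
by rewrite nth_incr_nth !(nth_map 0%N) ?size_iota ?nth_iota //= add0n.
Qed.

Lemma sumn_occupancy M f : all (fun k => k < M)%N f ->
  sumn (occupancy M f) = size f.
Proof.
elim: f => [_|k f IH /= /andP[kM fM]].
  by rewrite occupancy_nil sumn_nseq mul0n.
rewrite occupancy_cons // -IH //.
have : (k < size (occupancy M f))%N by rewrite size_map size_iota.
elim: k (occupancy M f) {kM} => [|k IHk] [|c cs] //= kcs.
by rewrite IHk // addnS.
Qed.

Section Occupancy.
Variable R : comPzRingType.
Implicit Types H : seq nat -> R.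

Definition occupancy_sum (M n : nat) H : R := \sum_(f <- words M n) H (occupancy M f).

Lemma occupancy_sum_cons M n H : occupancy_sum M n.+1 H =
  \sum_(k < M) occupancy_sum M n (fun c => H (incr_nth c k)).
Proof.
rewrite /occupancy_sum /= big_allpairs_dep.
transitivity (\sum_(0 <= k < M) \sum_(f <- words M n) H (occupancy M (k :: f))).
  by rewrite /index_iota subn0.
rewrite big_mkord; apply: eq_bigr => k _; apply: eq_bigr => f _.
by rewrite occupancy_cons.
Qed.

(** In a word of length [n], the [m] letters equal to 0 can be placed in
    ['C(n, m)] ways, and what remains is a word of length [n - m] on the other
    letters. Induction on [n] with Pascal's rule replaces this bijection. *)
Lemma occupancy_sumS M n H : occupancy_sum M.+1 n H =
  \sum_(m < n.+1) occupancy_sum M (n - m) (fun c => H ((m : nat) :: c)) *+ 'C(n, m).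
Proof.
elim: n H => [|n IH] H.
  rewrite big_ord_recl big_ord0 addr0 subn0 bin0 mulr1n.
  by rewrite /occupancy_sum /= !big_seq1 !occupancy_nil.
rewrite occupancy_sum_cons big_ord_recl IH /=.
rewrite [X in _ + X](eq_bigr _ (fun (k : 'I_M) _ => IH (fun c => H (incr_nth c k.+1)))).
rewrite exchange_big /=.
have -> : \sum_(m < n.+1) \sum_(k < M)
    occupancy_sum M (n - m) (fun c => H ((m : nat) :: incr_nth c k)) *+ 'C(n, m) =
  \sum_(m < n.+2) occupancy_sum M (n.+1 - m) (fun c => H ((m : nat) :: c)) *+ 'C(n, m).
  rewrite [RHS]big_ord_recr /= bin_small // mulr0n addr0.
  apply: eq_bigr => m _; have mn : (m <= n)%N by rewrite -ltnS.
  by rewrite sumrMnl subSn // occupancy_sum_cons.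
rewrite [in RHS]big_ord_recl [X in _ + X]big_ord_recl /= !bin0 addrCA; congr (_ + _).
rewrite -big_split; apply: eq_bigr => m _ /=.
by rewrite binS mulrnDr addrC /bump /= add1n subSS.
Qed.

Lemma eq_occupancy_sum M n H1 H2 :
  (forall c, size c = M -> sumn c = n -> H1 c = H2 c) ->
  occupancy_sum M n H1 = occupancy_sum M n H2.
Proof.
move=> H12; apply: eq_big_seq => f; rewrite mem_words => /andP[/eqP sf fM].
by apply: H12; rewrite ?size_map ?size_iota // sumn_occupancy.
Qed.

Lemma occupancy_sumZ M n (a : R) H :
  occupancy_sum M n (fun c => a * H c) = a * occupancy_sum M n H.
Proof. by rewrite /occupancy_sum mulr_sumr. Qed.

Variable mu : nat -> nat -> R.

(** If [mu m r] is the moment [E(Z^m (1 - Z)^r)], this is the probability that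
    the points of a given word with occupancy numbers [c] fall in the prescribed
    sticks: the factor of a stick is raised to the number of points in it, and
    its complement to the number of points further right. *)
Fixpoint stick_weight (c : seq nat) : R :=
  if c is m :: c' then mu m (sumn c') * stick_weight c' else 1.

(** The probability that all the points fall in the first [M] sticks and that
    they compose [la]. *)
Definition truncated_prob (M : nat) (la : seq nat) : R :=
  occupancy_sum M (sumn la)
    (fun c => ([seq m <- c | m != 0%N] == la)%:R * stick_weight c).

Lemma truncated_prob_nil M : mu 0 0 = 1 -> truncated_prob M [::] = 1.
Proof.
move=> mu00; rewrite /truncated_prob /occupancy_sum big_seq1 occupancy_nil.
elim: M => [|M IH] /=; first by rewrite mulr1.
by move: IH; rewrite sumn_nseq mul0n mu00 // mul1r.
Qed.

(** Regeneration at the first stick: it is empty, or it holds the first part of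
    the composition. Any other number of points in it contradicts [l :: la]. *)
Lemma truncated_probS M l la : (0 < l)%N ->
  let n := sumn (l :: la) in
  truncated_prob M.+1 (l :: la) = mu 0 n * truncated_prob M (l :: la)
    + 'C(n, l)%:R * mu l (sumn la) * truncated_prob M la.
Proof.
move=> l0 n; rewrite {1}/truncated_prob -/n occupancy_sumS big_ord_recl /= subn0 bin0 mulr1n.
congr (_ + _).
  rewrite /truncated_prob -/n -occupancy_sumZ; apply: eq_occupancy_sum => c _ cn.
  by rewrite cn mulrCA.
have ln : (l.-1 < n)%N by rewrite /n /= -{2}(prednK l0) addSn ltnS leq_addr.
rewrite (bigD1 (Ordinal ln)) //= /bump /= add1n prednK //.
rewrite [X in _ + X]big1 ?addr0; last first.
  move=> i il; rewrite add1n /occupancy_sum big1 ?mul0rn // => f _ /=.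
  case: eqP => [[il' _]|_]; last by rewrite mul0r.
  by move/eqP: il; case; apply/val_inj; rewrite /= -il'.
rewrite -[LHS]mulr_natl -mulrA; congr (_ * _).
rewrite /n /= addKn -occupancy_sumZ; apply: eq_occupancy_sum => c _ cn.
by rewrite eqseq_cons eqxx /= cn mulrCA.
Qed.

End Occupancy.

(** * Blocks of a set and measurability of the sampled composition *)

Section Blocks.
Context {R : realType}.
Implicit Types (U : set R) (x y z : R).

Lemma block_refl U x : block U x x.
Proof.
rewrite /block; case: ifPn => // /set_mem; exact: connected_component_refl.
Qed.

Lemma block_interval U x : is_interval (block U x).
Proof.
rewrite /block; case: ifPn => _.
  exact/connected_intervalP/component_connected.
by move=> y z -> -> t /le_anti ->.
Qed.

Lemma block_eq U x y : block U x y -> block U y = block U x.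
Proof.
rewrite {1}/block; case: ifPn => [xU xy|_ -> //].
have yU : y \in U by apply/mem_set/(connected_component_sub xy).
by rewrite /block xU yU (same_connected_component xy).
Qed.

(** The component of [x] is the union of the connected subsets that contain
    [x], and the connected sets are the intervals. *)
Lemma block_segment U x y : x < y ->
  (block U x = block U y) <-> (`[x, y] `<=` U).
Proof.
move=> xy; split=> [bxy|xyU].
  have: block U x y by rewrite bxy; exact: block_refl.
  have: block U x x by exact: block_refl.
  have := @block_interval U x; rewrite /block.
  case: ifPn => [xU I bx by_ z|_ _ _ yx]; last by rewrite yx ltxx in xy.
  rewrite /= in_itv /= => zxy; apply: (@connected_component_sub _ U x).
  exact: I bx by_ _ zxy.
apply/esym/block_eq; rewrite /block.
have xU : x \in U by apply/mem_set/xyU; rewrite /= in_itv /= lexx ltW.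
rewrite xU; apply: (connected_component_max _ xyU).
- by rewrite /= in_itv /= lexx ltW.
- exact: segment_connected.
- by rewrite /= in_itv /= lexx ltW.
Qed.

(** Distinct blocks are disjoint intervals: if [b <= a], then [b] lies in
    the block of [x], or [x] lies in the block of [y]. *)
Lemma block_lt U x y : block U x <> block U y -> x < y ->
  forall a b, block U x a -> block U y b -> a < b.
Proof.
move=> bxy xy a b xa yb; rewrite ltNge; apply/negP => ba; apply: bxy.
have [xb|/ltW bx] := leP x b.
  have xb' : block U x b.
    by apply: (@block_interval U x x a) => //; [exact: block_refl|rewrite xb].
  by rewrite -(block_eq xb') -(block_eq yb).
apply: (@block_eq U y); apply: (@block_interval U y b y) => //; first exact: block_refl.
by rewrite bx ltW.
Qed.

Lemma block_leE U x y :
  block_le (block U x) (block U y) = (block U x == block U y) || (x < y).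
Proof.
apply/asboolP/orP => [[->|xy]|[/eqP|xy]]; first by left.
- by right; apply: xy; exact: block_refl.
- by left.
- by case: (pselect (block U x = block U y)) => [|bxy]; [left|right; exact: block_lt].
Qed.

Definition break_point (Z : nat -> R) (k : nat) : R := 1 - \prod_(j < k) (1 - Z j).

Lemma segment_sub_paintbox (Z : nat -> R) x y : x <= y ->
  (`[x, y] `<=` stick_breaking_paintbox Z) <->
  [/\ 0 < x, y < 1 & forall k, ~~ (x <= break_point Z k.+1 <= y)].
Proof.
move=> xy; split=> [xyU|[x0 y1 xyk] z /=].
  have [|+ xn] := xyU x; first by rewrite /= in_itv /= lexx.
  rewrite /= in_itv /= => /andP[x0 x1].
  have [|+ yn] := xyU y; first by rewrite /= in_itv /= lexx xy.
  rewrite /= in_itv /= => /andP[y0 y1].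
  split.
  - by rewrite lt_neqAle x0 andbT; apply/eqP => e; apply: xn; left; left.
  - by rewrite lt_neqAle y1 andbT; apply/eqP => e; apply: yn; left; right.
  - move=> k; apply/negP => kxy.
    have [|_] := xyU (break_point Z k.+1); first by rewrite /= in_itv.
    by apply; right; exists k.
rewrite in_itv /= => /andP[xz zy]; split.
  by rewrite /= in_itv /= (le_trans (ltW x0)) //= (le_trans zy) // ltW.
case=> [[z0|z1]|[k _ zk]].
- by move: xz; rewrite z0 leNgt x0.
- by move: zy; rewrite z1 leNgt y1.
- by have /negP := xyk k; apply; rewrite /break_point zk xz.
Qed.

End Blocks.

Section MeasurableEvent.
Context {R : realType} {d : measure_display} {T : measurableType d}.

(** Only finitely many patterns of the tests exist, so the event is a finite
    union of intersections of the tests and their complements. *)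
Lemma measurable_determined (K : finType) (b : K -> T -> bool) (E : set T) :
  (forall k, measurable [set w | b k w]) ->
  (forall w w', (forall k, b k w = b k w') -> E w -> E w') ->
  measurable E.
Proof.
move=> mb Eb.
have -> : E = \bigcup_(m in [set m : {ffun K -> bool} |
    exists2 w, E w & forall k, b k w = m k]) \bigcap_(k in [set: K]) [set w | b k w = m k].
  apply/seteqP; split => [w Ew|w [m [w' Ew' bw'] bw]].
    exists [ffun k => b k w]; first by exists w => // k; rewrite ffunE.
    by move=> k _ /=; rewrite ffunE.
  by apply: Eb Ew' => k; rewrite bw' -bw.
apply: fin_bigcup_measurable; first exact: finite_finset.
move=> m _; apply: fin_bigcap_measurable; first exact: finite_finset.
move=> k _; case: (m k); first exact: mb.
rewrite (_ : [set w | b k w = false] = ~` [set w | b k w]); last first.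
  by apply/seteqP; split => w /=; [move=> -> | move/negP/negbTE].
exact: measurableC.
Qed.

Lemma measurable_set_ltr (f g : T -> R) :
  measurable_fun setT f -> measurable_fun setT g -> measurable [set w | f w < g w].
Proof.
move=> mf mg; have := measurable_fun_ltr mf mg measurableT (I : measurable [set true]).
by rewrite setTI; exact.
Qed.

Lemma measurable_set_ler (f g : T -> R) :
  measurable_fun setT f -> measurable_fun setT g -> measurable [set w | f w <= g w].
Proof.
move=> mf mg; have := measurable_fun_ler mf mg measurableT (I : measurable [set true]).
by rewrite setTI; exact.
Qed.

Lemma measurable_break_point (Z : nat -> T -> R) (k : nat) :
  (forall j, (j < k)%N -> measurable_fun setT (Z j)) ->
  measurable_fun setT (fun w => break_point (Z ^~ w) k).
Proof.
move=> mZ; apply: measurable_funB => //.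
elim: k mZ => [|k IH] mZ.
  by under eq_fun do rewrite big_ord0; exact: measurable_cst.
under eq_fun do rewrite big_ord_recr /=.
apply: measurable_funM; first by apply: IH => j jk; apply: mZ; rewrite ltnW.
by apply: measurable_funB => //; exact: mZ.
Qed.

Variable P : probability T R.
Variables (Z V : nat -> {RV P >-> R}).
Let U w := stick_breaking_paintbox (fun k => Z k w).

Lemma measurable_same_block i j :
  measurable [set w | block (U w) (V i w) == block (U w) (V j w)].
Proof.
pose S i j := [set w | 0 < V i w] `&` [set w | V j w < 1] `&`
  \bigcap_k ~` ([set w | V i w <= break_point (fun k => Z k w) k.+1] `&`
                [set w | break_point (fun k => Z k w) k.+1 <= V j w]).
have mS i' j' : measurable (S i' j').
  apply: measurableI; first by apply: measurableI; exact: measurable_set_ltr.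
  apply: bigcapT_measurable => k; apply: measurableC; apply: measurableI.
    by apply: measurable_set_ler => //; exact: measurable_break_point.
  by apply: measurable_set_ler => //; exact: measurable_break_point.
have SP i' j' w : V i' w < V j' w ->
    S i' j' w <-> block (U w) (V i' w) = block (U w) (V j' w).
  move=> ij; rewrite block_segment // segment_sub_paintbox ?ltW //.
  split=> [[[i0 j1] k]|[i0 j1 k]].
    by split => // m; apply/negP => /andP[? ?]; exact: (k m).
  by split => // m _ [? ?]; have /negP := k m; apply; apply/andP.
rewrite (_ : mkset _ = ([set w | V i w <= V j w] `&` [set w | V j w <= V i w]) `|`
   (([set w | V i w < V j w] `&` S i j) `|` ([set w | V j w < V i w] `&` S j i))).
  apply: measurableU; first by apply: measurableI; exact: measurable_set_ler.
  by apply: measurableU; apply: measurableI => //; exact: measurable_set_ltr.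
apply/seteqP; split => w /=.
  move=> /eqP bij; case: (ltgtP (V i w) (V j w)) => ij.
  - by right; left; split => //; exact/SP.
  - by right; right; split => //; exact/SP.
  - by left.
case=> [[ij ji]|[[ij /SP]|[ij /SP]]].
- by rewrite (@le_anti _ R (V i w) (V j w)) // ij ji.
- by move=> /(_ ij) ->.
- by move=> /(_ ij) ->.
Qed.

(** The tests are the pairwise comparisons of the points and the relations
    of lying in the same block. *)
Lemma measurable_sample_composition n la :
  measurable [set w | sample_composition (U w) [seq V i w | i <- iota 0 n] = la].
Proof.
pose b (p : bool * ('I_n * 'I_n)) w :=
  if p.1 then V p.2.1 w < V p.2.2 w
  else block (U w) (V p.2.1 w) == block (U w) (V p.2.2 w).
apply: (@measurable_determined _ b).
  move=> [[] [i j]]; rewrite /b /=; first exact: measurable_set_ltr.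
  exact: measurable_same_block.
have sE w : sample_composition (U w) [seq V i w | i <- iota 0 n] =
    runs (@block_le R) [seq block (U w) (V i w) | i : 'I_n <- enum 'I_n].
  rewrite sample_compositionE -val_enum_ord; congr runs.
  by elim: (enum 'I_n) => //= i s ->.
move=> w w' bww' <- /=; rewrite !sE; apply: esym; apply: runs_map_eq => i j /=;
  first exact: (bww' (false, (i, j))).
rewrite !block_leE; congr (_ || _); first exact: (bww' (false, (i, j))).
exact: (bww' (true, (i, j))).
Qed.

End MeasurableEvent.

(** * Independence of a variable from the history of others *)

Section Independence.
Context {R : realType} {d : measure_display} {T : measurableType d}.
Variables (P : probability T R) (I : eqType) (X : I -> {RV P >-> R}).
Hypothesis indX : mutually_independent X.

(** A pi-system that generates the sigma-algebra of the variables indexed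
    by [J]. *)
Definition cylinders (J : pred I) : set (set T) :=
  [set B | exists (s : seq I) (A : I -> set R),
     [/\ all J s, forall i, measurable (A i) &
         B = \big[setI/setT]_(i <- s) (X i @^-1` A i)]].

Lemma bigsetI_seq (s : seq I) (B : I -> set T) :
  \big[setI/setT]_(i <- s) B i = [set w | forall i, i \in s -> B i w].
Proof.
elim: s => [|j s IH]; first by rewrite big_nil; apply/esym/seteqP; split.
rewrite big_cons IH; apply/seteqP; split => w /=.
  by move=> [jw sw] i; rewrite inE => /predU1P[->|/sw].
by move=> jsw; split => [|i si]; apply: jsw; rewrite inE ?eqxx ?si ?orbT.
Qed.

Lemma measurable_preimage_RV (i : I) (A : set R) :
  measurable A -> measurable (X i @^-1` A).
Proof. by move=> mA; rewrite -[_ @^-1` _]setTI; exact: measurable_funPT. Qed.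

Lemma cylinders_measurable (J : pred I) : cylinders J `<=` measurable.
Proof.
move=> _ [s [A [_ mA ->]]]; apply: bigsetI_measurable => i _.
exact: measurable_preimage_RV.
Qed.

Lemma cylinders_setI (J : pred I) : setI_closed (cylinders J).
Proof.
move=> _ _ [s [A [Js mA ->]]] [t [B [Jt mB ->]]].
exists (s ++ t), (fun i => (if i \in s then A i else setT) `&`
                           (if i \in t then B i else setT)); split.
- by rewrite all_cat Js Jt.
- by move=> i; apply: measurableI; case: ifP.
rewrite !bigsetI_seq; apply/seteqP; split => w /=.
  by move=> [sw tw] i; rewrite mem_cat => ist; split; case: ifP => // ?; [exact: sw|exact: tw].
move=> stw; split => i ii.
  by have [] := stw i; rewrite ?mem_cat ii.
by have [] := stw i; rewrite ?mem_cat ii ?orbT.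
Qed.

Lemma cylindersT (J : pred I) : cylinders J setT.
Proof. by exists [::], (fun=> setT); split => //; rewrite big_nil. Qed.

(** The product rule is applied to the list of the cylinder extended by [i];
    this list must be free of duplicates, hence [undup]. *)
Lemma cylinder_indep (J : pred I) (i : I) (B : set T) (A : set R) :
  ~~ J i -> cylinders J B -> measurable A ->
  P (X i @^-1` A `&` B) = (P (X i @^-1` A) * P B)%E.
Proof.
move=> Ji [s [C [Js mC ->]]] mA.
have eu : \big[setI/setT]_(j <- s) (X j @^-1` C j) =
          \big[setI/setT]_(j <- undup s) (X j @^-1` C j).
  by rewrite !bigsetI_seq; apply: eq_set => w; apply: eq_forall => j; rewrite mem_undup.
rewrite eu; set u := undup s.
have iu : i \notin u by rewrite mem_undup; apply: contra Ji => /(allP Js).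
pose D j := if j == i then A else C j.
have eD : \big[setI/setT]_(j <- u) (X j @^-1` C j) = \big[setI/setT]_(j <- u) (X j @^-1` D j).
  apply: eq_big_seq => j ju; rewrite /D; case: eqP => // ji.
  by move: iu; rewrite -ji ju.
have mD j : measurable (D j) by rewrite /D; case: ifP.
have uiu : uniq (i :: u) by rewrite /= iu undup_uniq.
rewrite eD (indX (undup_uniq s) mD) -/u.
by have := indX uiu mD; rewrite !big_cons {1 3}/D eqxx.
Qed.

(** The sample space with the sigma-algebra generated by the variables in
    [J]; measurability with respect to it makes precise that a quantity depends
    on these variables only. *)
Definition history (J : pred I) := g_sigma_algebraType (cylinders J).

Lemma history_sub (J : pred I) (B : set T) :
  measurable (B : set (history J)) -> measurable B.
Proof. exact: (smallest_sub (@sigma_algebra_measurable _ T) (@cylinders_measurable J)). Qed.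

Lemma measurable_id_history (J : pred I) :
  measurable_fun setT (id : T -> history J).
Proof. by move=> _ B mB; rewrite setTI preimage_id; exact: (@history_sub J B mB). Qed.

Lemma measurable_history (J : pred I) (i : I) : J i ->
  measurable_fun setT (X i : history J -> R).
Proof.
move=> Ji _ A mA; rewrite setTI; apply: sub_sigma_algebra.
exists [:: i], (fun=> A); split => //=; first by rewrite Ji.
by rewrite big_cons big_nil setIT.
Qed.

(** The two sides are finite measures in [B] that agree on a generating
    pi-system. *)
Lemma history_indep (J : pred I) (i : I) (B : set (history J)) (A : set R) :
  ~~ J i -> measurable B -> measurable A ->
  P (X i @^-1` A `&` B) = (P (X i @^-1` A) * P B)%E.
Proof.
move=> Ji mB mA.
have mXA : measurable (X i @^-1` A) by exact: measurable_preimage_RV.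
have r : P (X i @^-1` A) \is a fin_num by exact: fin_num_measure.
pose r' : {nonneg R} := NngNum (fine_ge0 (measure_ge0 P (X i @^-1` A))).
pose m1 := mrestr P mXA.
pose m2 := mscale r' P.
have m1E C : m1 C = P (X i @^-1` A `&` C) by rewrite /m1 /= /mrestr setIC.
have m2E C : m2 C = (P (X i @^-1` A) * P C)%E.
  by rewrite /m2 /= /mscale /= fineK.
rewrite -m1E -m2E; apply: (g_sigma_algebra_measure_unique (cylinders J)
  (@cylinders_measurable J) (fun=> setT)) => //.
- by move=> _; exact: cylindersT.
- by rewrite bigcup_const.
- exact: cylinders_setI.
- move=> C cC; apply: (eq_trans (m1E C)); apply: (eq_trans _ (esym (m2E C))).
  exact: cylinder_indep Ji cC mA.
- by move=> _; apply: (eq_ind_r (fun x => x < +oo)%E _ (m1E setT)); rewrite setIT ltey_eq r.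
Qed.

Local Open Scope ereal_scope.

(** By independence, the law of [w |-> (X i w, w)] on [R * history J] is a
    product measure, so Tonelli's theorem integrates [X i] out with its history
    fixed. *)
Lemma integral_history (J : pred I) (i : I) (f : R * history J -> \bar R) :
  ~~ J i -> measurable_fun setT f -> (forall z, 0 <= f z) ->
  \int[P]_w f (X i w, w) = \int[P]_w \int[distribution P (X i)]_x f (x, w).
Proof.
move=> Ji mf f0.
have mid : isMeasurableFun _ _ T (history J) id.
  by split; exact: measurable_id_history.
pose idJ : {mfun T >-> history J} := HB.pack (id : T -> history J) mid.
have mpair : isMeasurableFun _ _ T (R * history J)%type (fun w => (X i w, w)).
  split; apply: measurable_fun_pair => //.
  exact: measurable_id_history.
pose pairJ : {mfun T >-> (R * history J)%type} :=
  HB.pack (fun w => (X i w, w) : R * history J) mpair.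
transitivity (\int[distribution P pairJ]_z f z).
  by rewrite ge0_integral_pushforward.
transitivity (\int[distribution P (X i) \x distribution P idJ]_z f z).
  apply: eq_measure_integral => C mC _; apply/esym.
  have := (@product_measure_unique _ _ _ _ _ (distribution P (X i)) (distribution P idJ)
    (distribution P pairJ)); apply => // A B mA mB.
  by rewrite /distribution /pushforward /= -(history_indep Ji mB mA).
rewrite fubini_tonelli2 // ge0_integral_pushforward //.
- exact: measurable_fun_fubini_tonelli_G.
- by move=> w _; exact: integral_ge0.
Qed.

End Independence.

(** * The beta integral and its recursion *)

Section BetaIntegral.
Context {R : realType}.
Implicit Types x y z : R.
Local Notation mu := lebesgue_measure.

Lemma beta_weight_ge0 x y z : 0 <= beta_weight x y z.
Proof. by rewrite mulr_ge0 // powR_ge0. Qed.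

Lemma beta_weightDl x y z : 0 < x -> 0 <= z ->
  beta_weight (x + 1) y z = z * beta_weight x y z.
Proof. by move=> x0 z0; rewrite /beta_weight addrK -(mulr_powRB1 z0 x0) mulrA. Qed.

Lemma beta_weightDr x y z : 0 < y -> z <= 1 ->
  beta_weight x (y + 1) z = (1 - z) * beta_weight x y z.
Proof.
move=> y0 z1; have z1' : 0 <= 1 - z by rewrite subr_ge0.
by rewrite /beta_weight addrK -(mulr_powRB1 z1' y0) mulrCA.
Qed.

Lemma beta_weightD x y z (p r : nat) : 0 < x -> 0 < y -> 0 <= z <= 1 ->
  beta_weight (x + p%:R) (y + r%:R) z = z ^+ p * (1 - z) ^+ r * beta_weight x y z.
Proof.
move=> x0 y0 /andP[z0 z1].
have -> : beta_weight (x + p%:R) (y + r%:R) z = z ^+ p * beta_weight x (y + r%:R) z.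
  elim: p => [|p IH]; first by rewrite addr0 expr0 mul1r.
  rewrite -natr1 addrA beta_weightDl ?IH ?exprS ?mulrA //.
  by rewrite ltr_pwDl.
rewrite -mulrA; congr (_ * _).
elim: r => [|r IH]; first by rewrite addr0 expr0 mul1r.
by rewrite -natr1 addrA beta_weightDr ?IH ?exprS ?mulrA // ltr_pwDl.
Qed.

Lemma measurable_beta_weight x y : measurable_fun setT (beta_weight x y).
Proof.
rewrite /beta_weight; apply: measurable_funM; first exact: measurable_powR.
apply: (measurableT_comp (f := fun z : R => z `^ (y - 1))); first exact: measurable_powR.
exact: measurable_funB.
Qed.

Lemma measurable_beta_weightE x y (D : set R) :
  measurable_fun D (EFin \o beta_weight x y).
Proof. by apply/measurable_EFinP/measurable_funTS; exact: measurable_beta_weight. Qed.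

(** The derivative of [z^x (1 - z)^y], whose boundary values vanish; it links
    the two beta integrals obtained by raising one parameter. *)
Lemma is_derive_beta_weight x y z : 0 < z < 1 ->
  is_derive z 1 (beta_weight (x + 1) (y + 1))
    (x * beta_weight x (y + 1) z - y * beta_weight (x + 1) y z).
Proof.
move=> /andP[z0 z1]; rewrite /beta_weight !addrK.
have z1' : 0 < 1 - z by rewrite subr_gt0.
have dx := is_derive1_powR x z0.
have dy : is_derive z 1 (fun z : R => (1 - z) `^ y) (- (y * (1 - z) `^ (y - 1))).
  have dy' := is_derive1_powR y z1'.
  have d1 : is_derive z 1 (fun z : R => 1 - z) (-1).
    by apply: is_derive_eq; rewrite add0r mul1r.
  have := is_derive1_comp (f := fun u : R => u `^ y) (g := fun z : R => 1 - z) dy' d1.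
  by rewrite mulrN1.
have dxy := is_deriveM dx dy.
have <- : z `^ x *: - (y * (1 - z) `^ (y - 1)) +
    (1 - z) `^ y *: (x * z `^ (x - 1)) =
    x * (z `^ (x - 1) * (1 - z) `^ y) - y * (z `^ x * (1 - z) `^ (y - 1)).
  by rewrite /GRing.scale /=; ring.
exact: dxy.
Qed.

Lemma continuous_beta_weight x y z : 0 < z < 1 -> {for z, continuous (beta_weight x y)}.
Proof.
move=> z01; apply/differentiable_continuous/derivable1_diffP.
have [d _] := is_derive_beta_weight (x - 1) (y - 1) z01.
by move: d; rewrite !subrK.
Qed.

(* The weights may be unbounded at both endpoints. The integrals are therefore
   computed on [cut n, 1 - cut n], starting at 1/3 so that this is never empty. *)
Let cut (n : nat) : R := n.+3%:R^-1.

Lemma cut_itv n : 0 < cut n /\ cut n < 1 - cut n.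
Proof.
split; first by rewrite invr_gt0.
rewrite ltrBrDl -mulr2n -mulr_natl ltr_pdivrMr // mul1r ltr_nat //.
Qed.

Lemma beta_weight_FTC x y n :
  (x%:E * \int[mu]_(z in `[cut n, (1 - cut n)%R]) (beta_weight x (y + 1)%R z)%:E -
   y%:E * \int[mu]_(z in `[cut n, (1 - cut n)%R]) (beta_weight (x + 1)%R y z)%:E =
   (beta_weight (x + 1) (y + 1) (1 - cut n) - beta_weight (x + 1) (y + 1) (cut n))%:E)%E.
Proof.
have [c0 c1] := cut_itv n.
have in01 z : z \in `[cut n, 1 - cut n] -> 0 < z < 1.
  rewrite in_itv /= => /andP[z0 z1]; rewrite (lt_le_trans c0) //=.
  by rewrite (le_lt_trans z1) // gtrBl.
have cw x' y' : {within `[cut n, 1 - cut n], continuous (beta_weight x' y')}.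
  apply: continuous_in_subspaceT => z /set_mem zc.
  by apply: continuous_beta_weight; exact: in01.
have iw x' y' : mu.-integrable `[cut n, 1 - cut n] (EFin \o beta_weight x' y').
  by apply: continuous_compact_integrable => //; exact: segment_compact.
have Zw k x' y' : (k%:E * \int[mu]_(z in `[cut n, (1 - cut n)%R]) (beta_weight x' y' z)%:E =
    \int[mu]_(z in `[cut n, (1 - cut n)%R]) (k * beta_weight x' y' z)%:E)%E.
  by apply/esym; apply: (integralZl _ (iw x' y') k).
have iZw k x' y' :
    mu.-integrable `[cut n, 1 - cut n] (EFin \o (fun z => k * beta_weight x' y' z)).
  by apply: (integrableZl _ k (iw x' y')).
rewrite !Zw -integralB_EFin //.
have := @continuous_FTC2 R
  (fun z => x * beta_weight x (y + 1) z - y * beta_weight (x + 1) y z)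
  (beta_weight (x + 1) (y + 1)) _ _ c1.
rewrite EFinB => <- //.
- apply: continuous_in_subspaceT => z /set_mem zc.
  have cz x' y' : {for z, continuous (beta_weight x' y')}.
    by apply: continuous_beta_weight; exact: in01.
  by apply: cvgB; apply: cvgMl_tmp; exact: cz.
- split.
  + move=> z zc; have /in01 z01 : z \in `[cut n, 1 - cut n] by exact: subset_itv_oo_cc.
    by have [] := is_derive_beta_weight x y z01.
  + apply: cvg_at_right_filter; apply: continuous_beta_weight; apply: in01.
    by rewrite in_itv /= lexx ltW.
  + apply: cvg_at_left_filter; apply: continuous_beta_weight; apply: in01.
    by rewrite in_itv /= lexx ltW.
- move=> z zc; have /in01 z01 : z \in `[cut n, 1 - cut n] by exact: subset_itv_oo_cc.
  by have [_] := is_derive_beta_weight x y z01; rewrite derive1E.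
Qed.

Lemma bigcup_cut : \bigcup_n `[cut n, 1 - cut n]%classic = `]0, 1[%classic.
Proof.
apply/seteqP; split => [z [n _] /=|z /=]; rewrite !in_itv /=.
  have [c0 c1] := cut_itv n.
  by move=> /andP[cz zc]; rewrite (lt_le_trans c0) //= (le_lt_trans zc) // gtrBl.
move=> /andP[z0 z1].
have m0 : 0 < Num.min z (1 - z) by rewrite lt_min z0 subr_gt0.
have [n _ nm] := near_infty_natSinv_lt (PosNum m0).
exists n => //=; rewrite in_itv /=.
have : cut n < Num.min z (1 - z).
  apply: le_lt_trans (nm n (leqnn n)) => /=.
  by rewrite lef_pV2 ?posrE // ler_nat; lia.
rewrite lt_min => /andP[/ltW -> cz] /=.
by rewrite lerBrDl -lerBrDr ltW.
Qed.

Local Open Scope ereal_scope.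

Definition beta_integral x y : \bar R := \int[mu]_(z in `[0%R, 1%R]) (beta_weight x y z)%:E.

Lemma beta_integral_ge0 x y : 0 <= beta_integral x y.
Proof. by apply: integral_ge0 => z _; rewrite lee_fin beta_weight_ge0. Qed.

Lemma cvg_beta_integral x y :
  \int[mu]_(z in `[cut n, (1 - cut n)%R]) (beta_weight x y z)%:E @[n --> \oo] -->
  beta_integral x y.
Proof.
rewrite /beta_integral integral_itv_bndoo; last exact: measurable_beta_weightE.
rewrite -bigcup_cut; apply: ge0_nondecreasing_set_cvg_integral.
- apply/nondecreasing_seqP => n; apply/subsetPset/subset_itvScc; rewrite bnd_simp.
    by rewrite lef_pV2 ?posrE // ler_nat.
  by rewrite lerB // lef_pV2 ?posrE // ler_nat.
- by move=> n; exact: measurable_itv.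
- by move=> n; exact: measurable_beta_weightE.
- by move=> n z _; rewrite lee_fin beta_weight_ge0.
Qed.

Lemma cvg_cut : (cut n @[n --> \oo] --> 0)%R.
Proof.
have := @cvg_harmonic R; rewrite -(cvg_shiftn 2); apply: cvg_trans.
by apply: near_eq_cvg; near=> n; rewrite /= addn2.
Unshelve. all: by end_near. Qed.

Lemma cvg_beta_weight_cut x y : (0 < x)%R -> (0 < y)%R ->
  (beta_weight (x + 1) (y + 1) (cut n) @[n --> \oo] --> 0)%R.
Proof.
move=> x0 y0.
apply: (@squeeze_cvgr _ _ _ _ (fun=> 0%R) (fun n => cut n `^ x)%R).
- near=> n; rewrite beta_weight_ge0 /= /beta_weight !addrK ler_piMr ?powR_ge0 //.
  have [c0 c1] := cut_itv n.
  rewrite -[leRHS](powRr0 (1 - cut n)); apply: ger_powR; last exact: ltW.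
  by rewrite (lt_trans c0 c1) /= gerBl ltW.
- exact: cvg_cst.
- have /cvg_at_rightP := powR_cvg0 x0; apply; split; last exact: cvg_cut.
  by move=> n; have [] := cut_itv n.
Unshelve. all: by end_near. Qed.

Lemma beta_weightC x y z : beta_weight x y (1 - z) = beta_weight y x z.
Proof. by rewrite /beta_weight subKr mulrC. Qed.

Lemma beta_integral_le x y x' y' :
  (forall z, (0 <= z <= 1)%R -> (beta_weight x' y' z <= beta_weight x y z)%R) ->
  beta_integral x y \is a fin_num -> beta_integral x' y' \is a fin_num.
Proof.
move=> le; rewrite !ge0_fin_numE; [|exact: beta_integral_ge0..]; apply: le_lt_trans.
apply: ge0_le_integral.
- exact: measurable_itv.
- by move=> z _; rewrite lee_fin beta_weight_ge0.
- exact: measurable_beta_weightE.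
- exact: measurable_beta_weightE.
- by move=> z; rewrite /= in_itv /= lee_fin; exact: le.
Qed.

(** From [z + (1 - z) = 1]. *)
Lemma beta_integral_split x y : (0 < x)%R -> (0 < y)%R ->
  beta_integral x y = beta_integral (x + 1)%R y + beta_integral x (y + 1)%R.
Proof.
move=> x0 y0; rewrite /beta_integral -ge0_integralD //; try exact: measurable_beta_weightE.
- apply: eq_integral => z; rewrite inE /= in_itv /= => /andP[z0 z1].
  rewrite -EFinD beta_weightDl // beta_weightDr // -mulrDl.
  by rewrite addrC subrK mul1r.
- by move=> z _; rewrite lee_fin beta_weight_ge0.
- by move=> z _; rewrite lee_fin beta_weight_ge0.
Qed.

Lemma beta_normE x y : beta_norm x y = fine (beta_integral x y).
Proof. by []. Qed.

Local Opaque beta_integral.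

Section Recursion.
Variables x y : R.
Hypotheses (x0 : (0 < x)%R) (y0 : (0 < y)%R).
Hypothesis fin_xy : beta_integral x y \is a fin_num.

Lemma beta_integralDl_fin : beta_integral (x + 1)%R y \is a fin_num.
Proof.
apply: (beta_integral_le _ fin_xy) => z /andP[z0 z1].
by rewrite beta_weightDl // ler_piMl // beta_weight_ge0.
Qed.

Lemma beta_integralDr_fin : beta_integral x (y + 1)%R \is a fin_num.
Proof.
apply: (beta_integral_le _ fin_xy) => z /andP[z0 z1].
by rewrite beta_weightDr // ler_piMl ?beta_weight_ge0 // gerBl.
Qed.

(** Integration by parts; the boundary terms vanish in the limit because both
    parameters are positive. *)
Lemma beta_integral_parts :
  x%:E * beta_integral x (y + 1)%R = y%:E * beta_integral (x + 1)%R y.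
Proof.
have fl := beta_integralDl_fin; have fr := beta_integralDr_fin.
have fA : x%:E * beta_integral x (y + 1)%R \is a fin_num by rewrite fin_numM.
have fB : y%:E * beta_integral (x + 1)%R y \is a fin_num by rewrite fin_numM.
suff : x%:E * beta_integral x (y + 1)%R - y%:E * beta_integral (x + 1)%R y = 0.
  rewrite -(fineK fA) -(fineK fB) -EFinB => -[/eqP].
  by rewrite subr_eq0 => /eqP ->.
have cl : (beta_weight (x + 1) (y + 1) (1 - cut n) - beta_weight (x + 1) (y + 1) (cut n))%:E
   @[n --> \oo] --> x%:E * beta_integral x (y + 1)%R - y%:E * beta_integral (x + 1)%R y.
  under eq_fun do rewrite -beta_weight_FTC.
  apply: cvgeB; first by rewrite fin_num_adde_defl // fin_numN.
    by apply: cvgeZl => //; exact: cvg_beta_integral.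
  by apply: cvgeZl => //; exact: cvg_beta_integral.
apply: (cvg_unique _ cl) => //.
apply: cvg_EFin; first by near=> n.
rewrite -[X in _ --> X]subr0; apply: cvgB.
  under eq_fun do rewrite /= beta_weightC.
  exact: cvg_beta_weight_cut.
exact: cvg_beta_weight_cut.
Unshelve. all: by end_near. Qed.

Local Open Scope ring_scope.

Lemma beta_normDl : (x + y) * beta_norm (x + 1) y = x * beta_norm x y.
Proof.
have fl := beta_integralDl_fin; have fr := beta_integralDr_fin.
have e1 := beta_integral_parts; have e2 := beta_integral_split x0 y0.
move: e1 e2; rewrite -(fineK fl) -(fineK fr) -(fineK fin_xy) -!EFinM -EFinD.
rewrite -!beta_normE => -[e1] [e2].
by rewrite e2 mulrDr e1 -mulrDl addrC.
Qed.

Lemma beta_normDr : (x + y) * beta_norm x (y + 1) = y * beta_norm x y.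
Proof.
have fl := beta_integralDl_fin; have fr := beta_integralDr_fin.
have e1 := beta_integral_parts; have e2 := beta_integral_split x0 y0.
move: e1 e2; rewrite -(fineK fl) -(fineK fr) -(fineK fin_xy) -!EFinM -EFinD.
rewrite -!beta_normE => -[e1] [e2].
by rewrite e2 mulrDr -e1 -mulrDl addrC.
Qed.

End Recursion.

Local Open Scope ring_scope.

(** Integration by parts and the splitting determine both raised integrals:
    [x] raised by 1 multiplies the integral by [x / (x + y)], and similarly for
    [y]. *)
Lemma beta_norm_pochhammer x y (p r : nat) : 0 < x -> 0 < y ->
  beta_integral x y \is a fin_num ->
  beta_integral (x + p%:R) (y + r%:R) \is a fin_num /\
  pochhammer (x + y) (p + r) * beta_norm (x + p%:R) (y + r%:R) =
    pochhammer x p * pochhammer y r * beta_norm x y.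
Proof.
move=> x0 y0 fxy; elim: p => [|p [IHf IH]].
  rewrite addr0 /pochhammer big_ord0 mul1r; elim: r => [|r [IHf IH]].
    by rewrite addr0 !big_ord0.
  rewrite -natr1 addrA; have yr : 0 < y + r%:R by rewrite ltr_pwDl.
  split; first exact: beta_integralDr_fin.
  rewrite addnS !big_ord_recr /= -/(pochhammer _ _) in IH *.
  rewrite -(mulrA _ (x + y + _)) add0n -[x + y + r%:R]addrA beta_normDr //.
  by rewrite mulrCA IH /pochhammer; ring.
rewrite -natr1 addrA; have xp : 0 < x + p%:R by rewrite ltr_pwDl.
have yr : 0 < y + r%:R by rewrite ltr_pwDl.
split; first exact: beta_integralDl_fin.
rewrite addSn /pochhammer !big_ord_recr /= -!/(pochhammer _ _).
have -> : x + y + (p + r)%:R = (x + p%:R) + (y + r%:R) by rewrite natrD; ring.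
rewrite -mulrA beta_normDl // mulrCA IH; ring.
Qed.

End BetaIntegral.

(** * Moments of a beta variable *)

Section Density.
Context {R : realType} {d : measure_display} {T : measurableType d}.
Variables (m mu : {measure set T -> \bar R}) (D : set T) (g : T -> R).
Hypotheses (mD : measurable D) (mg : measurable_fun D g).
Hypothesis g0 : forall x, D x -> 0 <= g x.
Hypothesis mE : forall A, measurable A -> m A = (\int[mu]_(x in A `&` D) (g x)%:E)%E.
Import HBNNSimple.
Local Open Scope ereal_scope.

Let integral_density_nnsfun (f : {nnsfun T >-> R}) :
  \int[m]_x (f x)%:E = \int[mu]_(x in D) ((f x)%:E * (g x)%:E).
Proof.
under [LHS]eq_integral do rewrite fimfunE -fsumEFin//.
rewrite [LHS]ge0_integral_fsum//; last 2 first.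
  - by move=> r; exact/measurable_EFinP/measurableT_comp.
  - by move=> n x _; rewrite EFinM nnfun_muleindic_ge0.
under [RHS]eq_integral.
  move=> x xD; rewrite fimfunE -fsumEFin// ge0_mule_fsuml; last first.
    by move=> r; rewrite EFinM nnfun_muleindic_ge0.
  over.
rewrite [RHS]ge0_integral_fsum//; last 2 first.
  - move=> r; apply: emeasurable_funM; last exact/measurable_EFinP.
    by apply/measurable_EFinP/measurable_funTS; exact: measurableT_comp.
  - move=> n x Dx; apply: mule_ge0; last by rewrite lee_fin g0.
    exact: nnfun_muleindic_ge0.
apply: eq_fsbigr => r /[!inE] -[z _ rE].
have r0 : (0 <= r)%R by rewrite -rE.
have mfr : measurable (f @^-1` [set r]) by exact: measurable_sfunP.
under [LHS]eq_integral do rewrite EFinM.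
rewrite integralZl_indic_nnsfun// integral_indic// setIT mE //.
under [RHS]eq_integral do rewrite EFinM -muleA.
rewrite [RHS]ge0_integralZl//; last 2 first.
  - apply: emeasurable_funM; last exact/measurable_EFinP.
    by apply/measurable_EFinP/measurable_funTS; exact: measurable_indic.
  - by move=> x Dx; rewrite mule_ge0 // lee_fin ?g0.
congr (_ * _); rewrite setIC integral_mkcondr.
by apply: eq_integral => x _; rewrite epatch_indic muleC.
Qed.

(** Both sides agree on indicator functions, hence on simple functions, and
    monotone convergence extends this to nonnegative functions. *)
Lemma integral_density (f : T -> \bar R) : measurable_fun setT f ->
  (forall x, 0 <= f x) ->
  \int[m]_x f x = \int[mu]_(x in D) (f x * (g x)%:E).
Proof.
move=> mf f0; pose h := nnsfun_approx measurableT mf.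
have mh n : measurable_fun setT (EFin \o h n) by exact/measurable_EFinP.
have nd x : nondecreasing_seq (fun n => (h n x)%:E).
  by move=> a b ab; rewrite lee_fin; exact/lefP/nd_nnsfun_approx.
have ch x : (h n x)%:E @[n --> \oo] --> f x by exact: cvg_nnsfun_approx.
transitivity (limn (fun n => \int[m]_x (h n x)%:E)).
  rewrite -monotone_convergence.
  - by apply: eq_integral => x _; apply/esym/cvg_lim => //; exact: ch.
  - by [].
  - exact: mh.
  - by move=> n x _; rewrite lee_fin.
  - by move=> x _; exact: nd.
transitivity (limn (fun n => \int[mu]_(x in D) ((h n x)%:E * (g x)%:E))).
  by apply: congr_lim; apply/funext => n; exact: integral_density_nnsfun.
rewrite -monotone_convergence//.
- apply: eq_integral => x _; apply/cvg_lim => //.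
  by apply: cvgeZr => //; exact: ch.
- move=> n; apply: emeasurable_funM; last exact/measurable_EFinP.
  apply: (measurable_funS measurableT) => //; exact: mh.
- by move=> n x Dx; rewrite mule_ge0 ?lee_fin ?g0.
- by move=> x Dx a b ab; rewrite lee_wpmul2r ?lee_fin ?g0 // -lee_fin; exact: nd.
Qed.

End Density.

Section Moments.
Context {R : realType}.
Implicit Types x a theta : R.

(** The factors lie in the unit interval only almost surely. Clipping them
    makes all lengths nonnegative at every sample point, as Tonelli's theorem
    requires, without changing any law. *)
Definition clip x : R := Num.max 0 (Num.min 1 x).

Lemma clip_ge0 x : 0 <= clip x. Proof. by rewrite le_max lexx. Qed.
Lemma clip_le1 x : clip x <= 1. Proof. by rewrite ge_max ler01 ge_min lexx. Qed.
Lemma clip_id x : 0 <= x <= 1 -> clip x = x.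
Proof. by move=> /andP[x0 x1]; rewrite /clip (min_idPr x1) (max_idPr x0). Qed.
Lemma measurable_clip : measurable_fun setT clip.
Proof. by apply: measurable_maxr => //; exact: measurable_minr. Qed.

Definition moment_fun (p r : nat) x : R := clip x ^+ p * (1 - clip x) ^+ r.

Lemma moment_fun_ge0 p r x : 0 <= moment_fun p r x.
Proof. by rewrite mulr_ge0 // exprn_ge0 ?clip_ge0 // subr_ge0 clip_le1. Qed.

Lemma measurable_moment_fun p r : measurable_fun setT (moment_fun p r).
Proof.
apply: measurable_funM; apply: measurable_funX; first exact: measurable_clip.
by apply: measurable_funB => //; exact: measurable_clip.
Qed.

Definition beta_moment a theta (p r : nat) : R :=
  pochhammer a p * pochhammer theta r / pochhammer (a + theta) (p + r).

Lemma pochhammer_gt0 x n : 0 < x -> 0 < pochhammer x n.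
Proof. by move=> x0; apply: prodr_gt0 => i _; rewrite ltr_pwDl. Qed.

Context {d : measure_display} {T : measurableType d} (P : probability T R).
Variables (a theta : R) (Z : {RV P >-> R}).
Hypotheses (a0 : 0 < a) (theta0 : 0 < theta) (Zlaw : has_law Z (beta_law a theta)).

Lemma beta_law_total :
  ((beta_norm a theta)^-1%:E * beta_integral a theta = 1)%E.
Proof.
have := Zlaw measurableT; rewrite /beta_law setTI.
under eq_integral do rewrite EFinM.
rewrite ge0_integralZl //.
- by move=> <-; rewrite /distribution /pushforward preimage_setT probability_setT.
- exact: measurable_beta_weightE.
- by move=> z _; rewrite lee_fin beta_weight_ge0.
- by rewrite lee_fin invr_ge0 fine_ge0 // beta_integral_ge0.
Qed.

(** The existence of a random variable with the beta law forces this: an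
    infinite integral would give the normalizing constant 0 and total mass 0. *)
Lemma beta_integral_fin : beta_integral a theta \is a fin_num.
Proof.
rewrite ge0_fin_numE ?beta_integral_ge0 // ltey; apply/eqP => oo.
have := beta_law_total; rewrite beta_normE oo /= invr0 mul0e => -[] /eqP.
by rewrite eq_sym oner_eq0.
Qed.

Lemma beta_norm_neq0 : beta_norm a theta != 0.
Proof.
apply/eqP => e; have := beta_law_total; rewrite e invr0 mul0e => -[] /eqP.
by rewrite eq_sym oner_eq0.
Qed.

Lemma probability_unit_interval : P (Z @^-1` ~` `[0, 1]) = 0%E.
Proof.
have := Zlaw (measurableC (measurable_itv `[0, 1])).
by rewrite /beta_law setICl integral_set0.
Qed.

(** Multiplying the beta density by [z^p (1 - z)^r] raises its parameters. *)
Lemma integral_moment_fun p r :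
  (\int[distribution P Z]_x (moment_fun p r x)%:E = (beta_moment a theta p r)%:E)%E.
Proof.
have [fpr npr] := beta_norm_pochhammer p r a0 theta0 beta_integral_fin.
have c0 : 0 <= (beta_norm a theta)^-1.
  by rewrite invr_ge0 fine_ge0 // beta_integral_ge0.
have g0 x : `[0, 1]%classic x -> 0 <= (beta_norm a theta)^-1 * beta_weight a theta x.
  by move=> _; rewrite mulr_ge0 // beta_weight_ge0.
pose g := (fun z => (beta_norm a theta)^-1 * beta_weight a theta z) : measurableTypeR R -> R.
have mg (D : set (measurableTypeR R)) : measurable_fun D g.
  apply: measurable_funM => //; apply: measurable_funTS; exact: measurable_beta_weight.
pose f := (fun x => (moment_fun p r x)%:E) : measurableTypeR R -> \bar R.
have mf : measurable_fun setT f by apply/measurable_EFinP; exact: measurable_moment_fun.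
have f0 x : (0 <= f x)%E by rewrite lee_fin moment_fun_ge0.
have mZ : isMeasurableFun _ _ T (measurableTypeR R) Z by split; exact: measurable_funPT Z.
pose Z' : {mfun T >-> measurableTypeR R} := HB.pack (Z : T -> measurableTypeR R) mZ.
transitivity (\int[distribution P Z']_x f x)%E.
  rewrite (ge0_integral_distribution Z' mf f0) ge0_integral_distribution //.
rewrite (integral_density (m := distribution P Z') (measurable_itv _) (mg _) g0 Zlaw mf f0).
transitivity ((beta_norm a theta)^-1%:E *
    beta_integral (a + p%:R) (theta + r%:R))%E.
  rewrite /beta_integral -ge0_integralZl //.
  - apply: eq_integral => z; rewrite inE /= in_itv /= => z01.
    rewrite -!EFinM /moment_fun clip_id // beta_weightD //.
    by congr EFin; rewrite mulrCA.
  - exact: measurable_beta_weightE.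
  - by move=> z _; rewrite lee_fin beta_weight_ge0.
rewrite -(fineK fpr) -beta_normE -EFinM; congr EFin.
have n0 := beta_norm_neq0.
have h0 : pochhammer (a + theta) (p + r) != 0.
  by rewrite gt_eqF // pochhammer_gt0 // addr_gt0.
apply: (mulIf h0); rewrite divfK // -mulrA [X in _ * X]mulrC npr mulrC mulfK //.
Qed.

End Moments.

(** * The probability that given points fall in given sticks *)

Section StickWeight.
Variables (R : comPzRingType) (mu : nat -> nat -> R).

Lemma stick_weightE c : stick_weight mu c =
  \prod_(k < size c) mu (nth 0%N c k) (sumn (drop k.+1 c)).
Proof.
elim: c => [|m c IH] /=; first by rewrite big_ord0.
by rewrite big_ord_recl /= drop0 IH.
Qed.

Lemma sumn_count_mem (s f : seq nat) : uniq s ->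
  sumn [seq count_mem j f | j <- s] = count (mem s) f.
Proof.
elim: s => [_|j s IH /= /andP[js us]].
  by rewrite -(eq_count (a1 := pred0)) ?count_pred0.
rewrite IH // -count_predUI [X in (_ + X)%N](eq_count (a2 := pred0)).
  by rewrite count_pred0 addn0; apply: eq_count => i; rewrite /= inE.
by move=> i /=; apply/negP => /andP[/eqP ->]; exact/negP.
Qed.

(** The number of points to the right of stick [k] is the sum of the later
    occupancy numbers. *)
Lemma stick_weight_occupancy M f : all (fun k => k < M)%N f ->
  stick_weight mu (occupancy M f) =
  \prod_(k < M) mu (count_mem (k : nat) f) (count (fun j => k < j)%N f).
Proof.
move=> /allP fM; rewrite stick_weightE size_map size_iota.
apply: eq_bigr => k _; rewrite (nth_map 0%N) ?size_iota // nth_iota // add0n.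
congr (mu _ _); rewrite -map_drop drop_iota sumn_count_mem ?iota_uniq //.
apply: eq_in_count => j /fM jM; rewrite /= mem_iota add0n.
by rewrite subnKC // jM andbT.
Qed.

End StickWeight.

Section Sticks.
Context {R : realType} {d : measure_display} {T : measurableType d}.
Variables (P : probability T R) (a theta : R) (Z V : nat -> {RV P >-> R}).
Hypotheses (a0 : 0 < a) (theta0 : 0 < theta).
Hypothesis Zlaw : forall k, has_law (Z k) (beta_law a theta).
Hypothesis Vlaw : forall i, has_law (V i) (uniform_prob (@ltr01 R)).
Let X (s : nat + nat) := match s with inl k => Z k | inr i => V i end.
Hypothesis indX : mutually_independent X.

Definition stick_end (k : nat) (w : T) : R := break_point (fun j => clip (Z j w)) k.

Definition stick_length (k : nat) (w : T) : R :=
  clip (Z k w) * \prod_(j < k) (1 - clip (Z j w)).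

Lemma stick_endS k w : stick_end k.+1 w = stick_end k w + stick_length k w.
Proof. by rewrite /stick_end /break_point /stick_length big_ord_recr /=; ring. Qed.

Lemma stick_end0 w : stick_end 0 w = 0.
Proof. by rewrite /stick_end /break_point big_ord0 subrr. Qed.

Lemma stick_length_ge0 k w : 0 <= stick_length k w.
Proof.
rewrite mulr_ge0 ?clip_ge0 //; apply: prodr_ge0 => j _.
by rewrite subr_ge0 clip_le1.
Qed.

Lemma stick_end_le k m w : (k <= m)%N -> stick_end k w <= stick_end m w.
Proof.
elim: m => [|m IH]; first by rewrite leqn0 => /eqP ->.
rewrite leq_eqVlt => /predU1P[-> //|/IH]; rewrite stick_endS => /le_trans; apply.
by rewrite lerDl stick_length_ge0.
Qed.

Lemma stick_end_ge0 k w : 0 <= stick_end k w.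
Proof. by rewrite -(stick_end0 w) stick_end_le. Qed.

Lemma stick_end_le1 k w : stick_end k w <= 1.
Proof.
rewrite /stick_end /break_point gerBl; apply: prodr_ge0 => j _.
by rewrite subr_ge0 clip_le1.
Qed.

Definition in_stick (k : nat) (w : T) : set R := `]stick_end k w, stick_end k.+1 w[%classic.

(** Given the factors, a sample point falls in a stick with probability its
    length. *)
Lemma uniform_in_stick i k w :
  distribution P (V i) (in_stick k w) = (stick_length k w)%:E.
Proof.
have m : measurable (in_stick k w) by exact: measurable_itv.
rewrite (Vlaw i m) /uniform_prob integral_uniform_pdf.
rewrite setIidl; last first.
  move=> x; rewrite /= !in_itv /= => /andP[x0 x1].
  rewrite (ltW (le_lt_trans (stick_end_ge0 _ _) x0)) /=.
  exact: ltW (lt_le_trans x1 (stick_end_le1 _ _)).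
rewrite (eq_integral (cst 1%E)) => [|x]; last first.
  rewrite /in_stick inE /= in_itv /= => /andP[x0 x1].
  rewrite /uniform_pdf (ltW (le_lt_trans (stick_end_ge0 _ _) x0)).
  by rewrite (ltW (lt_le_trans x1 (stick_end_le1 _ _))) subr0 invr1.
rewrite integral_cst ?mul1e; last exact: m.
apply: (eq_trans (lebesgue_measure_itv `]stick_end k w, stick_end k.+1 w[)).
rewrite /= lte_fin stick_endS ltrDl.
case: ltP => [_|l0]; first by rewrite -EFinB addrAC subrr add0r.
by apply/esym/congr1/le_anti; rewrite l0 stick_length_ge0.
Qed.

(** The ends and lengths of the sticks are measurable with respect to any
    history that contains all the factors. *)
Definition contains_factors (J : pred (nat + nat)) := forall k, J (inl k).

Lemma measurable_clip_history (J : pred (nat + nat)) k : J (inl k) ->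
  measurable_fun setT (fun w : history X J => clip (Z k w)).
Proof.
move=> Jk; apply: measurableT_comp; first exact: measurable_clip.
exact: (measurable_history (X := X) Jk).
Qed.

Lemma measurable_stick_end_history (J : pred (nat + nat)) k : contains_factors J ->
  measurable_fun setT (stick_end k : history X J -> R).
Proof.
move=> ZJ; apply: measurable_break_point => j _.
exact: measurable_clip_history (ZJ j).
Qed.

Lemma measurable_stick_length_history (J : pred (nat + nat)) k : contains_factors J ->
  measurable_fun setT (stick_length k : history X J -> R).
Proof.
move=> ZJ.
have -> : stick_length k = (fun w => stick_end k.+1 w - stick_end k w).
  by apply/funext => w; rewrite stick_endS addrAC subrr add0r.
by apply: measurable_funB; exact: measurable_stick_end_history.
Qed.

Definition in_sticks (f : seq nat) (w : T) : Prop :=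
  forall i, (i < size f)%N -> in_stick (nth 0%N f i) w (V i w).

Lemma in_sticks_rcons f k w :
  in_sticks (rcons f k) w <-> in_sticks f w /\ in_stick k w (V (size f) w).
Proof.
split=> [fk|[fw kw] i].
  split=> [i fi|].
    by have := fk i; rewrite size_rcons nth_rcons fi ltnS ltnW // => /(_ erefl).
  by have := fk (size f); rewrite size_rcons nth_rcons ltnn eqxx ltnSn => /(_ erefl).
rewrite size_rcons ltnS nth_rcons leq_eqVlt => /predU1P[->|fi].
  by rewrite ltnn eqxx.
by rewrite fi; exact: fw.
Qed.

(** All the factors and the first [n] sample points. *)
Definition stick_history (n : nat) : pred (nat + nat) :=
  fun s => if s is inr i then (i < n)%N else true.

Lemma measurable_in_sticks_history f (J : pred (nat + nat)) : contains_factors J ->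
  (forall i, (i < size f)%N -> J (inr i)) ->
  measurable (in_sticks f : set (history X J)).
Proof.
elim/last_ind: f => [|f k IH] ZJ fJ.
  rewrite (_ : in_sticks [::] = setT) //.
  by apply/seteqP; split => // w _ [].
rewrite (_ : in_sticks _ = in_sticks f `&`
    ([set w | stick_end k w < V (size f) w] `&`
     [set w | V (size f) w < stick_end k.+1 w])); last first.
  apply/seteqP; split => w.
    move=> /in_sticks_rcons[fw]; rewrite /in_stick /= in_itv /= => /andP[? ?].
    by split.
  move=> [fw [/= l r]]; apply/in_sticks_rcons; split => //.
  by rewrite /in_stick /= in_itv /= l.
have mV : measurable_fun setT (V (size f) : history X J -> R).
  by apply: (measurable_history (X := X) (i := inr (size f))); apply: fJ; rewrite size_rcons.
apply: measurableI.
  by apply: IH => // i fi; apply: fJ; rewrite size_rcons ltnS ltnW.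
by apply: measurableI; apply: measurable_set_ltr => //; exact: measurable_stick_end_history.
Qed.

Local Open Scope ereal_scope.

(** The sample points are integrated out one at a time, the last one first,
    its history being the factors and the earlier points. The weight [H] absorbs
    the lengths already produced. *)
Lemma integral_in_sticks f (H : T -> R) :
  (forall J : pred (nat + nat), contains_factors J -> measurable_fun setT (H : history X J -> R)) ->
  (forall w, (0 <= H w)%R) ->
  \int[P]_w (\1_(in_sticks f) w * H w)%:E =
  \int[P]_w ((\prod_(k <- f) stick_length k w) * H w)%:E.
Proof.
elim/last_ind: f H => [|f k IH] H mH H0.
  apply: eq_integral => w _; rewrite big_nil indicE mem_set // => i //.
pose J := stick_history (size f).
have ZJ : contains_factors J by [].
pose S : set (R * history X J) :=
  [set z | stick_end k z.2 < z.1]%R `&` [set z | z.1 < stick_end k.+1 z.2]%R.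
have me m : measurable_fun setT (fun z : R * history X J => stick_end m z.2).
  exact: (measurableT_comp (measurable_stick_end_history m ZJ) measurable_snd).
have mS : measurable S.
  by apply: measurableI; apply: measurable_set_ltr => //; exact: me.
have mf : measurable (in_sticks f : set (history X J)).
  by apply: measurable_in_sticks_history.
have mfw : measurable_fun setT (fun w : history X J => \1_(in_sticks f) w * H w : R)%R.
  apply: measurable_funM; last exact: mH.
  by apply: measurable_indic.
pose F (z : R * history X J) := (\1_S z * (\1_(in_sticks f) z.2 * H z.2))%:E.
have mF : measurable_fun setT F.
  apply/measurable_EFinP; apply: measurable_funM; first exact: measurable_indic.
  exact: (measurableT_comp mfw).
have F0 z : 0 <= F z by rewrite lee_fin !mulr_ge0.
transitivity (\int[P]_w F (X (inr (size f)) w, w)).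
  apply: eq_integral => w _; rewrite /F /= mulrA; congr ((_ * _)%:E).
  rewrite !indicE -natrM mulnb; congr ((nat_of_bool _)%:R).
  apply/idP/andP => [/set_mem/in_sticks_rcons[fw]|[/set_mem Sw /set_mem fw]].
    rewrite /in_stick /= in_itv /= => /andP[l r].
    by split; exact/mem_set.
  apply/mem_set/in_sticks_rcons; split => //.
  by rewrite /in_stick /= in_itv /=; apply/andP.
have nJ : ~~ J (inr (size f)) by rewrite /J /= ltnn.
rewrite (integral_history indX nJ mF F0) /=.
transitivity (\int[P]_w (\1_(in_sticks f) w * (stick_length k w * H w))%:E).
  apply: eq_integral => w _; rewrite /F /=.
  rewrite (eq_integral (fun x => (\1_(in_sticks f) w * H w)%:E * (\1_(in_stick k w) x)%:E)).
    have ms : measurable (in_stick k w) by exact: measurable_itv.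
    rewrite ge0_integralZl.
    - rewrite integral_indic // setIT.
      rewrite -[X in (_ * X)%E]/(distribution P (V (size f)) (in_stick k w)).
      by rewrite uniform_in_stick -EFinM -mulrA [(H w * _)%R]mulrC.
    - by [].
    - by apply/measurable_EFinP; exact: measurable_indic.
    - by move=> x _; rewrite lee_fin.
    - by rewrite lee_fin mulr_ge0.
  move=> x _; rewrite -EFinM mulrC; congr ((_ * _)%:E).
  rewrite !indicE; congr ((nat_of_bool _)%:R).
  apply/idP/idP => /set_mem.
    by move=> [/= l r]; apply/mem_set; rewrite /in_stick /= in_itv /= l.
  by rewrite /in_stick /= in_itv /= => /andP[l r]; exact/mem_set.
rewrite IH.
- by apply: eq_integral => w _; rewrite big_rcons /= mulrA [(_ * stick_length _ _)%R]mulrC.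
- move=> J' ZJ'; apply: measurable_funM; last exact: mH.
  exact: measurable_stick_length_history.
- by move=> w; rewrite mulr_ge0 // stick_length_ge0.
Qed.

Lemma measurable_in_sticks f : measurable (in_sticks f).
Proof.
apply: (history_sub (X := X) (J := predT)).
exact: measurable_in_sticks_history.
Qed.

(** The expectation of a product over independent factors, again by
    integrating out the last one. *)
Lemma integral_prod_moment_fun M (p r : nat -> nat) :
  \int[P]_w (\prod_(k < M) moment_fun (p k) (r k) (Z k w))%:E =
  (\prod_(k < M) beta_moment a theta (p k) (r k))%:E.
Proof.
elim: M => [|M IH].
  under eq_integral do rewrite big_ord0; rewrite big_ord0.
  by rewrite integral_cst // mul1e; exact: probability_setT.
pose J : pred (nat + nat) := fun s => if s is inl k then (k < M)%N else false.
pose H w := (\prod_(k < M) moment_fun (p k) (r k) (Z k w))%R.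
have mH : measurable_fun setT (H : history X J -> R).
  apply: measurable_prod => k _.
  apply: (measurableT_comp (measurable_moment_fun (p k) (r k))).
  by apply: (measurable_history (X := X) (i := inl (k : nat))) => /=.
have H0 w : (0 <= H w)%R by apply: prodr_ge0 => k _; exact: moment_fun_ge0.
pose F (z : R * history X J) := (moment_fun (p M) (r M) z.1 * H z.2)%:E.
have mF : measurable_fun setT F.
  apply/measurable_EFinP; apply: measurable_funM.
    exact: (measurableT_comp (measurable_moment_fun _ _) measurable_fst).
  exact: (measurableT_comp mH measurable_snd).
have F0 z : 0 <= F z by rewrite lee_fin mulr_ge0 // moment_fun_ge0.
have nJ : ~~ J (inl M) by rewrite /J /= ltnn.
transitivity (\int[P]_w F (X (inl M) w, w)).
  by apply: eq_integral => w _; rewrite big_ord_recr /= mulrC.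
rewrite (integral_history indX nJ mF F0) /=.
have mm : measurable_fun [set: R] (EFin \o moment_fun (p M) (r M)).
  by apply/measurable_EFinP; exact: measurable_moment_fun.
have mHP : measurable_fun setT (EFin \o H).
  apply/measurable_EFinP; apply: measurable_prod => k _.
  by apply: (measurableT_comp (measurable_moment_fun (p k) (r k))).
transitivity (\int[P]_w ((beta_moment a theta (p M) (r M))%:E * (H w)%:E)).
  apply: eq_integral => w _; rewrite /F /=.
  under eq_integral do rewrite mulrC EFinM.
  rewrite ge0_integralZl //.
  - by rewrite (integral_moment_fun a0 theta0 (Zlaw M)) muleC.
  - by move=> x _; rewrite lee_fin moment_fun_ge0.
  - by rewrite lee_fin.
rewrite ge0_integralZl //.
- by rewrite IH -EFinM big_ord_recr /= mulrC.
- by move=> w _; rewrite lee_fin.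
- rewrite lee_fin divr_ge0 ?mulr_ge0 //; apply: ltW; apply: pochhammer_gt0 => //.
  exact: addr_gt0.
Qed.

Local Open Scope ring_scope.

(** Stick [m] contributes its own factor once and the complements of all the
    earlier factors once, so collecting the word by factors yields the
    exponents. *)
Lemma prod_stick_length M f w : all (fun k => k < M)%N f ->
  \prod_(k <- f) stick_length k w =
  \prod_(k < M) moment_fun (count_mem (k : nat) f) (count (fun j => k < j)%N f) (Z k w).
Proof.
elim: f => [_|m f IH /= /andP[mM fM]].
  rewrite big_nil big1 // => k _; rewrite /moment_fun mul1r //.
rewrite big_cons IH //.
under [RHS]eq_bigr => k _ do
  rewrite /moment_fun !exprD mulrACA -/(moment_fun _ _ _).
rewrite [RHS]big_split /=; congr (_ * _); rewrite big_split /= /stick_length; congr (_ * _).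
  rewrite (bigD1 (Ordinal mM)) //= eqxx expr1 big1 ?mulr1 // => k km.
  case: eqP => [e|]; last by rewrite expr0.
  by move: km; rewrite -val_eqE /= e eqxx.
rewrite (big_ord_widen M (fun j => 1 - clip (Z j w))) ?(ltnW mM) // big_mkcond.
by apply: eq_bigr => k _; case: ifP; rewrite ?expr0 ?expr1.
Qed.

Lemma prob_in_sticks M f : all (fun k => k < M)%N f ->
  P (in_sticks f) = (stick_weight (beta_moment a theta) (occupancy M f))%:E.
Proof.
move=> fM; rewrite stick_weight_occupancy //.
rewrite -(integral_prod_moment_fun M (fun k => count_mem k f)
  (fun k => count (fun j => k < j)%N f)).
transitivity (\int[P]_w (\1_(in_sticks f) w * 1)%:E)%E.
  under eq_integral do rewrite mulr1.
  by rewrite integral_indic ?setIT //; exact: measurable_in_sticks.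
rewrite integral_in_sticks //.
by apply: eq_integral => w _; rewrite mulr1 (prod_stick_length w fM).
Qed.

End Sticks.

(** * Regeneration of the composition structure *)

Section Regeneration.
Context {R : realType} {d : measure_display} {T : measurableType d}.
Variables (P : probability T R) (a theta : R) (Z V : nat -> {RV P >-> R}).
Hypotheses (a0 : 0 < a) (theta0 : 0 < theta).
Hypothesis Zlaw : forall k, has_law (Z k) (beta_law a theta).
Hypothesis Vlaw : forall i, has_law (V i) (uniform_prob (@ltr01 R)).
Hypothesis indX : mutually_independent
  (fun s : nat + nat => match s with inl k => Z k | inr i => V i end).
Let U w := stick_breaking_paintbox (fun k => Z k w).
Local Notation mom := (beta_moment a theta).

(** On this almost sure event, clipping has no effect. *)
Definition unit_factors : set T := [set w | forall k, 0 <= Z k w <= 1].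

Lemma stick_end_unit w k : unit_factors w ->
  stick_end Z k w = break_point (fun j => Z j w) k.
Proof.
by move=> Zw; rewrite /stick_end; congr (break_point _ k); apply/funext => j; rewrite clip_id.
Qed.

Lemma in_stick_lt w k m x y : (k < m)%N ->
  in_stick Z k w x -> in_stick Z m w y -> x < y.
Proof.
move=> km; rewrite /in_stick /= !in_itv /= => /andP[_ xk] /andP[my _].
by apply: (lt_trans xk); apply: le_lt_trans my; exact: stick_end_le.
Qed.

(** A stick contains no break point, and the right end of stick [k] separates
    it from all the later sticks. *)
Lemma block_in_stick w k m x y : unit_factors w ->
  in_stick Z k w x -> in_stick Z m w y -> (block (U w) x == block (U w) y) = (k == m).
Proof.
move=> Zw.
wlog km : k m x y / (k <= m)%N.
  move=> H xk ym; case: (leqP k m) => [|/ltnW] km; first exact: H.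
  by rewrite eq_sym [RHS]eq_sym; exact: H.
move=> xk ym; move: km; rewrite leq_eqVlt => /predU1P[km|km].
  subst m; rewrite eqxx; apply/eqP.
  wlog xy : x y xk ym / x < y.
    move=> H; case: (ltgtP x y) => [xy|yx|-> //]; first exact: H.
    by apply/esym/H.
  apply/(block_segment _ xy)/segment_sub_paintbox; first exact: ltW.
  move: xk ym; rewrite /in_stick /= !in_itv /= => /andP[kx _] /andP[_ yk]; split.
  - exact: le_lt_trans (stick_end_ge0 _ _ _) kx.
  - exact: lt_le_trans yk (stick_end_le1 _ _ _).
  - move=> j; rewrite -stick_end_unit //; apply/negP => /andP[xj jy].
    have [jk|kj] := ltnP j k.
      have := lt_le_trans kx xj; rewrite ltNge => /negP; apply.
      exact: stick_end_le.
    have := le_lt_trans jy yk; rewrite ltNge => /negP; apply.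
    exact: stick_end_le.
rewrite (ltn_eqF km); apply/negbTE/eqP.
have xy := in_stick_lt km xk ym.
move=> /(block_segment _ xy)/(segment_sub_paintbox _ (ltW xy)) [_ _ /(_ k)].
rewrite -stick_end_unit //; move: xk ym; rewrite /in_stick /= !in_itv /=.
move=> /andP[_ xk] /andP[my _]; rewrite (ltW xk) /= => /negP; apply.
by apply: ltW; apply: le_lt_trans my; exact: stick_end_le.
Qed.

(** Numbering the sticks from left to right preserves equality and order of
    blocks. *)
Lemma sample_composition_in_sticks w M f : unit_factors w ->
  all (fun k => k < M)%N f -> in_sticks Z V f w ->
  sample_composition (U w) [seq V i w | i <- iota 0 (size f)] =
  [seq c <- occupancy M f | c != 0%N].
Proof.
move=> Zw fM fw; rewrite -(runs_nat fM) sample_compositionE.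
set n := size f.
have -> : f = [seq nth 0%N f i | i : 'I_n <- enum 'I_n].
  by rewrite -[LHS](mkseq_nth 0%N) /mkseq -val_enum_ord -map_comp.
have -> : [seq block (U w) x | x <- [seq V i w | i <- iota 0 n]] =
    [seq block (U w) (V i w) | i : 'I_n <- enum 'I_n].
  by rewrite -val_enum_ord; elim: (enum 'I_n) => //= i s ->.
have bE (i j : 'I_n) : (block (U w) (V i w) == block (U w) (V j w)) =
    (nth 0%N f i == nth 0%N f j).
  by apply: block_in_stick => //; exact: fw.
apply: runs_map_eq => i j; first exact: bE.
rewrite block_leE bE leq_eqVlt; case: ltngtP => //= ij.
  exact: in_stick_lt ij (fw i (ltn_ord i)) (fw j (ltn_ord j)).
apply/negbTE; rewrite -leNgt ltW //.
exact: in_stick_lt ij (fw j (ltn_ord j)) (fw i (ltn_ord i)).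
Qed.

Lemma in_sticks_inj w f g : size f = size g ->
  in_sticks Z V f w -> in_sticks Z V g w -> f = g.
Proof.
move=> fg fw gw; apply: (@eq_from_nth _ 0%N) => // i fi.
have gi : (i < size g)%N by rewrite -fg.
by case: (ltngtP (nth 0%N f i) (nth 0%N g i)) => // fgi;
  [have := in_stick_lt fgi (fw i fi) (gw i gi)|
   have := in_stick_lt fgi (gw i gi) (fw i fi)]; rewrite ltxx.
Qed.

Lemma measurable_unit_factors : measurable unit_factors.
Proof.
rewrite (_ : unit_factors = \bigcap_k (Z k @^-1` `[0, 1])); last first.
  apply/seteqP; split => w; first by move=> Zw k _; rewrite /= in_itv; exact: Zw.
  by move=> Zw k; have := Zw k I; rewrite /= in_itv.
by apply: bigcapT_measurable => k; exact: measurable_preimage_RV.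
Qed.

Lemma negligible_unit_factors : P (~` unit_factors) = 0%E.
Proof.
apply/negligibleP; first by apply: measurableC; exact: measurable_unit_factors.
rewrite (_ : ~` unit_factors = \bigcup_k (Z k @^-1` ~` `[0, 1])); last first.
  apply/seteqP; split => w.
    by move=> /existsNP[k Zk]; exists k => //=; rewrite in_itv.
  by move=> [k _ /=]; rewrite in_itv /= => Zk /(_ k).
apply: negligible_bigcup => k; apply/negligibleP.
  by apply: measurable_preimage_RV; apply: measurableC.
exact: (probability_unit_interval (Zlaw k)).
Qed.

Lemma measureI_unit_factors A : measurable A -> P (A `&` unit_factors) = P A.
Proof.
move=> mA; have mZ := measurable_unit_factors.
rewrite [RHS](measureDI _ mA mZ) -[LHS]add0e; congr (_ + _)%E.
apply/esym/eqP; rewrite -measure_le0 -negligible_unit_factors.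
by apply: le_measure => [||w []] //; rewrite inE; [exact: measurableD|exact: measurableC].
Qed.

(** Expanding the power of the total length of the first [M] sticks. *)
Lemma prod_words w M n :
  \sum_(f <- words M n) \prod_(k <- f) stick_length Z k w = stick_end Z M w ^+ n.
Proof.
have sE : \sum_(k <- iota 0 M) stick_length Z k w = stick_end Z M w.
  elim: M => [|M IH]; first by rewrite big_nil stick_end0.
  by rewrite -addn1 iotaD big_cat /= IH big_seq1 add0n addn1 stick_endS.
elim: n => [|n IH]; first by rewrite big_seq1 big_nil expr0.
rewrite /= big_allpairs_dep exprS -IH -sE mulr_suml; apply: eq_bigr => k _.
by rewrite mulr_sumr; apply: eq_bigr => f _; rewrite big_cons.
Qed.

Lemma bernoulli_le (x : R) n : 0 <= x <= 1 -> 1 <= (1 - x) ^+ n + n%:R * x.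
Proof.
move=> /andP[x0 x1]; elim: n => [|n IH]; first by rewrite expr0 mul0r addr0.
have y0 : 0 <= 1 - x by rewrite subr_ge0.
have := ler_wpM2l y0 IH; rewrite exprS -natr1.
have n0 : 0 <= n%:R * x ^+ 2 by rewrite mulr_ge0 // sqr_ge0.
move: n0; move: ((1 - x) ^+ n) (n%:R : R) => u v; nra.
Qed.

(** The event that the [n] points fall in the first [M] sticks. Points that
    hit a break point are excluded, at the cost of a null event. *)
Definition sticks M n : set T := \big[setU/set0]_(f <- words M n) in_sticks Z V f.

Local Open Scope ereal_scope.

Lemma measure_words M n (A : set T) : measurable A ->
  P (A `&` sticks M n) = \sum_(f <- words M n) P (A `&` in_sticks Z V f).
Proof.
move=> mA; rewrite /sticks.
suff H s : uniq s -> {subset s <= words M n} ->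
    P (A `&` \big[setU/set0]_(f <- s) in_sticks Z V f) =
    \sum_(f <- s) P (A `&` in_sticks Z V f).
  by apply: H => //; exact: uniq_words.
elim: s => [_ _|f s IH /= /andP[fs us] ss].
  by rewrite !big_nil setI0 measure0.
have ms : measurable (\big[setU/set0]_(g <- s) in_sticks Z V g).
  by apply: bigsetU_measurable => g _; exact: measurable_in_sticks.
rewrite !big_cons setIUr measureU.
- by congr (_ + _)%E; apply: IH => // g gs; apply: ss; rewrite inE gs orbT.
- by apply: measurableI => //; exact: measurable_in_sticks.
- exact: measurableI.
apply/seteqP; split => w // [[_ fw] [_]].
rewrite -bigcup_seq => -[g /= gs gw].
have : f \in words M n by apply: ss; rewrite inE eqxx.
have : g \in words M n by apply: ss; rewrite inE gs orbT.
rewrite !mem_words => /andP[/eqP sg _] /andP[/eqP sf _].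
by move: fs; rewrite (in_sticks_inj _ fw gw) ?gs // sf.
Qed.

Lemma measurable_sticks M n : measurable (sticks M n).
Proof. by apply: bigsetU_measurable => f _; exact: measurable_in_sticks. Qed.

Lemma measurable_stick_length k : measurable_fun setT (stick_length Z k).
Proof.
rewrite /stick_length; apply: measurable_funM.
  by apply: measurableT_comp => //; exact: measurable_clip.
apply: measurable_prod => j _; apply: measurable_funB => //.
by apply: measurableT_comp => //; exact: measurable_clip.
Qed.

(** Given the factors, the points fall in the first [M] sticks with probability
    [(1 - x)^n], where [x] is the product of the complements of the first [M]
    factors. This is at least [1 - n x], and the mean of [x] is [mom 0 1 ^ M]. *)
Lemma prob_sticks_ge M n : 1 <= P (sticks M n) + (n%:R * mom 0 1 ^+ M)%:E.
Proof.
have mp f : measurable_fun setT (fun w => \prod_(k <- f) stick_length Z k w)%R.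
  by apply: measurable_prod => k _; exact: measurable_stick_length.
have mx : measurable_fun setT (fun w => \prod_(k < M) moment_fun 0 1 (Z k w))%R.
  apply: measurable_prod => k _.
  by apply: (measurableT_comp (measurable_moment_fun 0 1)).
have me : measurable_fun setT (stick_end Z M).
  apply: measurable_break_point => j _; apply: measurableT_comp => //.
  exact: measurable_clip.
have p0 f w : (0 <= \prod_(k <- f) stick_length Z k w)%R.
  by apply: prodr_ge0 => k _; exact: stick_length_ge0.
have x0 w : (0 <= \prod_(k < M) moment_fun 0 1 (Z k w))%R.
  by apply: prodr_ge0 => k _; exact: moment_fun_ge0.
have -> : P (sticks M n) = \int[P]_w (stick_end Z M w ^+ n)%:E.
  under eq_integral do rewrite -prod_words -sumEFin.
  rewrite ge0_integral_sum //; first last.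
  - by move=> f w _; rewrite lee_fin.
  - by move=> f; apply/measurable_EFinP; exact: mp.
  rewrite -[sticks M n]setTI measure_words //.
  apply: eq_bigr => f _; rewrite setTI.
  transitivity (\int[P]_w (\1_(in_sticks Z V f) w * 1)%:E).
    under eq_integral do rewrite mulr1.
    by rewrite integral_indic ?setIT //; exact: measurable_in_sticks.
  rewrite integral_in_sticks //.
  by apply: eq_integral => w _; rewrite mulr1.
have -> : (n%:R * mom 0 1 ^+ M)%:E =
    \int[P]_w (n%:R%:E * (\prod_(k < M) moment_fun 0 1 (Z k w))%:E).
  rewrite ge0_integralZl //; first last.
  - by move=> w _; rewrite lee_fin.
  - exact/measurable_EFinP.
  rewrite (integral_prod_moment_fun a0 theta0 Zlaw indX M (fun=> 0%N) (fun=> 1%N)).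
  by rewrite prodr_const card_ord -EFinM.
rewrite -ge0_integralD //; first last.
- by apply: measurable_funeM; exact/measurable_EFinP.
- by move=> w _; rewrite mule_ge0 ?lee_fin.
- exact/measurable_EFinP/measurable_funX.
- by move=> w _; rewrite lee_fin exprn_ge0 // stick_end_ge0.
have <- : \int[P]_w (cst 1 w) = 1.
  by rewrite integral_cst // mul1e; exact: probability_setT.
apply: ge0_le_integral => //.
- apply: emeasurable_funD; last by apply: measurable_funeM; exact/measurable_EFinP.
  exact/measurable_EFinP/measurable_funX.
- move=> w _; rewrite -EFinM -EFinD lee_fin.
  have -> : stick_end Z M w = (1 - \prod_(k < M) moment_fun 0 1 (Z k w))%R.
    by congr (_ - _)%R; apply: eq_bigr => k _; rewrite /moment_fun expr0 expr1 mul1r.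
  apply: bernoulli_le; rewrite x0 /=.
  apply: prodr_ile1 => k _; rewrite moment_fun_ge0 /moment_fun expr0 expr1 mul1r.
  by rewrite gerBl clip_ge0.
Qed.

Lemma prob_in_sticks_composition M n f la : f \in words M n ->
  let E := [set w | sample_composition (U w) [seq V i w | i <- iota 0 n] = la] in
  P (E `&` in_sticks Z V f) =
  (([seq c <- occupancy M f | c != 0%N] == la)%:R *
     stick_weight mom (occupancy M f))%:E.
Proof.
rewrite mem_words => /andP[/eqP sf fM] E.
have mE : measurable E by exact: measurable_sample_composition.
have mf := measurable_in_sticks Z V f.
rewrite -(measureI_unit_factors (measurableI _ _ mE mf)).
case: eqP => [fla|fla]; last first.
  rewrite mul0r (_ : _ `&` _ = set0) ?measure0 //.
  apply/seteqP; split => // w [[Ew fw] Zw]; apply: fla; rewrite -Ew /= -sf.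
  exact/esym/sample_composition_in_sticks.
rewrite mul1r -(prob_in_sticks a0 theta0 Zlaw Vlaw indX fM).
rewrite -[RHS](measureI_unit_factors mf); congr (P _).
apply/seteqP; split => [w [[_ fw] Zw] //|w [fw Zw]]; split => //; split => //.
rewrite /E /= -sf -fla; exact: sample_composition_in_sticks.
Qed.

Local Open Scope ring_scope.

Lemma mom01_lt1 : 0 <= mom 0 1 < 1.
Proof.
rewrite /beta_moment /pochhammer big_ord0 !big_ord1 !addr0 mul1r.
have at0 : 0 < a + theta by exact: addr_gt0.
by rewrite divr_ge0 ?ltW //= ltr_pdivrMr // mul1r ltrDr.
Qed.

(** Compared with the full probability, the truncation loses at most the event
    that some point misses the first [M] sticks. *)
Lemma cvg_truncated_prob la (r : R) :
  paintbox_prob (fun w => stick_breaking_paintbox (fun k => Z k w)) V la = r%:E ->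
  truncated_prob mom M la @[M --> \oo] --> r.
Proof.
set n := sumn la; rewrite /paintbox_prob -/n => Pr.
pose E := [set w | sample_composition (U w) [seq V i w | i <- iota 0 n] = la].
have mE : measurable E by exact: measurable_sample_composition.
have /andP[b0 b1] := mom01_lt1.
have bounds M : r - n%:R * mom 0 1 ^+ M <= truncated_prob mom M la <= r.
  have mS := measurable_sticks M n.
  have PS : P (E `&` sticks M n) = (truncated_prob mom M la)%:E.
    rewrite measure_words // /truncated_prob /occupancy_sum -sumEFin.
    by apply: eq_big_seq => f fw; exact: prob_in_sticks_composition.
  have PE : r%:E = (P (E `\` sticks M n) + (truncated_prob mom M la)%:E)%E.
    by rewrite -PS -(measureDI _ mE mS) -Pr.
  have S1 := prob_sticks_ge M n.
  have PC : (P (E `\` sticks M n) + P (sticks M n) <= 1)%E.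
    have mD : measurable (E `\` sticks M n) by exact: measurableD.
    rewrite -measureU //; first exact: probability_le1 (measurableU _ _ mD mS).
    by apply/seteqP; split => // w [[_ ?]].
  move: S1 PC PE.
  have fS : P (sticks M n) \is a fin_num by exact: fin_num_measure.
  have fD : P (E `\` sticks M n) \is a fin_num.
    by apply: fin_num_measure; exact: measurableD.
  have D0 : 0 <= fine (P (E `\` sticks M n)) by rewrite fine_ge0.
  move: D0; rewrite -(fineK fS) -(fineK fD) -!EFinD !lee_fin /=.
  move: (fine _) (fine _) (n%:R * _) => x y z x0 S1 PC [->]; lra.
apply: (@squeeze_cvgr _ _ _ _ (fun M => r - n%:R * mom 0 1 ^+ M) (fun=> r)).
- by near=> M; exact: bounds.
- rewrite -[X in _ --> X]subr0; apply: cvgB; first exact: cvg_cst.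
  rewrite -[X in _ --> X](mulr0 (n%:R : R)); apply: cvgMl_tmp.
  by apply: cvg_expr; rewrite ger0_norm.
- exact: cvg_cst.
Unshelve. all: by end_near. Qed.

End Regeneration.

Lemma beta_moment00 (R : realType) (a theta : R) : beta_moment a theta 0 0 = 1.
Proof. by rewrite /beta_moment /pochhammer !big_ord0 divr1 mulr1. Qed.

Section Structure.
Variables (R : realType) (a theta : R) (q : seq nat -> R).
Hypotheses (a0 : 0 < a) (theta0 : 0 < theta).
Hypothesis qP : stick_breaking_structure (beta_law a theta) q.
Local Notation mom := (beta_moment a theta).

Let cvg_q la : all (leq 1) la -> truncated_prob mom M la @[M --> \oo] --> q la.
Proof.
move=> la1; have [d [T [P [Z [V [Zlaw Vlaw indX qE]]]]]] := qP.
apply: (cvg_truncated_prob a0 theta0 Zlaw Vlaw indX).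
by apply: (qE (sumn la)); rewrite /is_composition la1 eqxx.
Qed.

Lemma structure_nil : q [::] = 1.
Proof.
have := cvg_q (la := [::]) erefl.
rewrite (_ : (fun M => _) = fun=> 1); last first.
  by apply/funext => M; rewrite truncated_prob_nil // beta_moment00.
by move=> c; apply: (cvg_unique _ c) => //; exact: cvg_cst.
Qed.

Lemma structure_cons l la : all (leq 1) (l :: la) ->
  let n := sumn (l :: la) in
  q (l :: la) = mom 0 n * q (l :: la) + 'C(n, l)%:R * mom l (sumn la) * q la.
Proof.
move=> /[dup] lla /= /andP[l0 la1].
have c1 := cvg_q lla; have c2 := cvg_q la1.
have := c1; rewrite -cvg_shiftS.
rewrite (_ : [sequence _]_ _ = fun M =>
    mom 0 (sumn (l :: la)) * truncated_prob mom M (l :: la) +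
    'C(sumn (l :: la), l)%:R * mom l (sumn la) * truncated_prob mom M la); last first.
  by apply/funext => M /=; exact: truncated_probS.
move=> c; apply: (cvg_unique _ c) => //.
by apply: cvgD; apply: cvgMl_tmp.
Qed.

End Structure.

(** * The limit of the decrement probabilities *)

Section Limit.
Variables (R : realType) (theta : R).
Hypothesis theta0 : 0 < theta.
Implicit Types a : R.

(** The divided difference [([a + theta]_n - [theta]_n) / a] as a polynomial in
    [a], so that it makes sense and is continuous at 0. *)
Fixpoint pochhammer_slope (n : nat) a : R :=
  if n is n'.+1 then pochhammer_slope n' a * (a + theta + n'%:R) + pochhammer theta n'
  else 0.

Lemma pochhammerS (x : R) n : pochhammer x n.+1 = pochhammer x n * (x + n%:R).
Proof. exact: big_ord_recr. Qed.

Lemma pochhammer_slopeE n a :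
  pochhammer (a + theta) n = pochhammer theta n + a * pochhammer_slope n a.
Proof.
elim: n => [|n IH]; first by rewrite /pochhammer !big_ord0 mulr0 addr0.
by rewrite !pochhammerS IH /=; ring.
Qed.

Lemma pochhammer_slope_ge0 n a : 0 < a -> 0 <= pochhammer_slope n a.
Proof.
move=> a0; elim: n => //= n IH; rewrite addr_ge0 //.
  by rewrite mulr_ge0 // addr_ge0 // ltW // addr_gt0.
by rewrite ltW // pochhammer_gt0.
Qed.

Lemma pochhammer_slope_gt0 n a : 0 < a -> (0 < n)%N -> 0 < pochhammer_slope n a.
Proof.
case: n => // n a0 _ /=; apply: ltr_wpDl; last exact: pochhammer_gt0.
rewrite mulr_ge0 ?pochhammer_slope_ge0 // addr_ge0 // ltW // addr_gt0 //.
Qed.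

Lemma h_thetaS n : h_theta theta n.+1 = h_theta theta n + (theta + n%:R)^-1.
Proof.
by rewrite /h_theta big_nat_recr //= -natr1 addrA addrK.
Qed.

Lemma h_theta_gt0 n : (0 < n)%N -> 0 < h_theta theta n.
Proof.
elim: n => // -[_ _|n IH _]; rewrite h_thetaS.
  by rewrite /h_theta big_geq // add0r invr_gt0 addr0.
by rewrite addr_gt0 ?IH // invr_gt0 ltr_pwDl.
Qed.

(** The derivative of a product of linear factors is the product times the sum
    of the inverses of the factors. *)
Lemma cvg_pochhammer_slope n :
  pochhammer_slope n a @[a --> 0^'+] --> pochhammer theta n * h_theta theta n.
Proof.
elim: n => [|n IH] /=.
  by rewrite /h_theta big_geq // mulr0; exact: cvg_cst.
have tn : theta + n%:R != 0 by rewrite gt_eqF // ltr_pwDl.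
have -> : pochhammer theta n.+1 * h_theta theta n.+1 =
    pochhammer theta n * h_theta theta n * (0 + theta + n%:R) + pochhammer theta n.
  rewrite pochhammerS h_thetaS add0r mulrDr -[_ * _ * (_)^-1]mulrA divff // mulr1.
  by rewrite mulrAC.
apply: cvgD; last exact: cvg_cst.
apply: cvgM => //; apply: cvgD; last exact: cvg_cst.
apply: cvgD; last exact: cvg_cst.
exact: cvg_at_right_filter (@cvg_id _ _).
Qed.

Lemma pochhammer_recl (x : R) n : pochhammer x n.+1 = x * pochhammer (x + 1) n.
Proof.
rewrite /pochhammer big_ord_recl /= addr0; congr (_ * _).
by apply: eq_bigr => i _; rewrite /bump /= -addrA nat1r.
Qed.

Lemma cvg_pochhammer1 l : pochhammer (a + 1) l @[a --> 0^'+] --> (l`!%:R : R).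
Proof.
elim: l => [|l IH].
  by under eq_fun do rewrite /pochhammer big_ord0; rewrite fact0; exact: cvg_cst.
under eq_fun do rewrite pochhammerS.
have -> : l.+1`!%:R = l`!%:R * (0 + 1 + l%:R) :> R.
  by rewrite factS natrM mulrC -natr1 add0r [1 + _]addrC.
apply: cvgM => //; apply: cvgD; last exact: cvg_cst.
apply: cvgD; last exact: cvg_cst.
exact: cvg_at_right_filter (@cvg_id _ _).
Qed.

(** The probability that the first part is [l] when [n] points are sampled,
    after cancelling a factor [a]. Since [[a]_l = a [a + 1]_(l - 1)], the
    numerator keeps the predecessor of [l]. *)
Definition decrement a (n l : nat) : R :=
  'C(n, l)%:R * pochhammer (a + 1) l.-1 * pochhammer theta (n - l) / pochhammer_slope n a.

(** The recursion determines [q (l :: la)] because its coefficient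
    [1 - mu 0 n] is positive: for [a > 0] it is the slope times
    [a / [a + theta]_n]. *)
Lemma structure_decrement (q : seq nat -> R) a l la : 0 < a ->
  stick_breaking_structure (beta_law a theta) q -> all (leq 1) (l :: la) ->
  q (l :: la) = decrement a (sumn (l :: la)) l * q la.
Proof.
move=> a0 qP lla; have l0 : (0 < l)%N by case/andP: lla.
have := structure_cons a0 theta0 qP lla; set n := sumn _ => /= e.
have n0 : (0 < n)%N by rewrite /n /= ltn_addr.
have nl : (n - l)%N = sumn la by rewrite /n /= addKn.
have p0 : pochhammer (a + theta) n != 0 by rewrite gt_eqF // pochhammer_gt0 // addr_gt0.
have s0 : pochhammer_slope n a != 0 by rewrite gt_eqF // pochhammer_slope_gt0.
have m0 : beta_moment a theta 0 n = 1 - a * pochhammer_slope n a / pochhammer (a + theta) n.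
  rewrite /beta_moment {1}/pochhammer big_ord0 mul1r add0n.
  apply: (mulIf p0); rewrite mulrBl !divfK // mul1r pochhammer_slopeE; ring.
have ml : beta_moment a theta l (sumn la) =
    a * (pochhammer (a + 1) l.-1 * pochhammer theta (n - l)) / pochhammer (a + theta) n.
  by rewrite /beta_moment -{1}(prednK l0) pochhammer_recl nl -!mulrA.
rewrite m0 ml in e.
have {}e : a * pochhammer_slope n a / pochhammer (a + theta) n * q (l :: la) =
   'C(n, l)%:R * (a * (pochhammer (a + 1) l.-1 * pochhammer theta (n - l)) /
      pochhammer (a + theta) n) * q la by lra.
have k0 : a / pochhammer (a + theta) n != 0.
  by rewrite mulf_neq0 ?invr_eq0 // gt_eqF.
apply: (mulfI k0); apply: (mulfI s0); rewrite /decrement.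
transitivity (a * pochhammer_slope n a / pochhammer (a + theta) n * q (l :: la)).
  by ring.
by rewrite e; field; rewrite p0 s0.
Qed.

Lemma g_limit_cons l la : (0 < l)%N -> let n := sumn (l :: la) in
  g_limit theta (l :: la) =
  'C(n, l)%:R * l.-1`!%:R * pochhammer theta (n - l) /
    (pochhammer theta n * h_theta theta n) * g_limit theta la.
Proof.
move=> l0 n; rewrite /g_limit big_ord_recl /= -/n.
have nl : (n - l)%N = sumn la by rewrite /n /= addKn.
have ln : (l <= n)%N by rewrite /n /= leq_addr.
rewrite nl; set p := \prod_(i < _) _.
have -> : n`!%:R = 'C(n, l)%:R * (l%:R * l.-1`!%:R) * (sumn la)`!%:R :> R.
  rewrite -!natrM -nl -mulnA.
  by rewrite (_ : (l * l.-1`!)%N = l`!) ?bin_fact //; case: (l) l0.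
rewrite invfM.
have l1 : l%:R != 0 :> R by rewrite pnatr_eq0 -lt0n.
have t1 : pochhammer theta (sumn la) != 0 by rewrite gt_eqF // pochhammer_gt0.
have t2 : pochhammer theta n != 0 by rewrite gt_eqF // pochhammer_gt0.
rewrite (invfM (pochhammer theta n)).
move: (h_theta theta n)^-1 => h.
by field; rewrite l1 t1 t2.
Qed.

End Limit.

Theorem theorem3 (R : realType) (theta : R) (q : R -> seq nat -> R)
  (theta_gt0 : 0 < theta)
  (q_derived : forall a : R, 0 < a ->
     stick_breaking_structure (beta_law a theta) (q a))
  (n : nat) (la : seq nat) (n_gt0 : (1 <= n)%N) (la_comp : is_composition n la) :
  q a la @[a --> 0^'+] --> g_limit theta la.
Proof.
have {n n_gt0 la_comp} la1 : all (leq 1) la by case/andP: la_comp.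
elim: la la1 => [_|l la IH /[dup] lla /= /andP[l0 la1]].
  have -> : g_limit theta [::] = 1.
    by rewrite /g_limit /= /pochhammer !big_ord0 fact0 divr1 mulr1.
  apply: (@cvg_trans _ ((fun=> 1 : R) @ 0^'+)); last exact: cvg_cst.
  apply: near_eq_cvg; near=> a.
  have a0 : 0 < a by near: a; exact: nbhs_right_gt.
  exact/esym/(structure_nil a0 theta_gt0 (q_derived a a0)).
rewrite g_limit_cons //; set n := sumn _.
apply: (@cvg_trans _ ((decrement theta a n l * q a la) @[a --> 0^'+])).
  apply: near_eq_cvg; near=> a.
  have a0 : 0 < a by near: a; exact: nbhs_right_gt.
  exact/esym/(structure_decrement theta_gt0 a0 (q_derived a a0)).
apply: cvgM; last exact: IH.
apply: cvgM.
  apply: cvgM; last exact: cvg_cst.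
  by apply: cvgMl_tmp; exact: cvg_pochhammer1.
have n0 : (0 < n)%N by rewrite /n /= ltn_addr.
apply: cvgV; last exact: cvg_pochhammer_slope.
by rewrite mulf_neq0 // gt_eqF // ?pochhammer_gt0 ?h_theta_gt0.
Unshelve. all: by end_near. Qed.
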